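(* $C_5(3)=3$. That is, $\limsup_{t\to\infty} \frac{N_5(t,3)}{\log_2 t} = 3$, where $N_5(t,3)$ is the minimal worst-case total number of tests needed to find all $3$ defective elements among $t$ samples by an algorithm using at most $5$ stages.
   Context: Group testing model: there are $t$ samples, indexed by $[t]=\{1,\dots,t\}$, among which an unknown set $S_{un}$ of exactly $s$ samples is defective. A test is performed on a chosen subset $T\subseteq[t]$; its outcome is positive (1) if $T\cap S_{un}\neq\emptyset$ and negative (0) otherwise; outcomes are always correct (noiseless). A $p$-stage algorithm is divided into $p$ stages; the tests of stage $i$ are all chosen before any test of stage $i$ is performed, and may depend on the outcomes of all tests from stages $1,\dots,i-1$. The algorithm must determine $S_{un}$ exactly for every possible $S_{un}$ with $|S_{un}|=s$. $N_p(t,s)$ denotes the minimal, over all $p$-stage algorithms, worst-case (over $S_{un}$) total number of tests, and $C_p(s)=\limsup_{t\to\infty} N_p(t,s)/\log_2 t$. *)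

(* Defs.v *)
From HB Require Import structures.
From mathcomp Require Import all_boot all_order all_algebra.
From mathcomp Require Import all_classical all_reals all_analysis.
Set Implicit Arguments. Unset Strict Implicit. Unset Printing Implicit Defensive.
Import Order.TTheory GRing.Theory Num.Theory.

(* Samples are 'I_t (i.e. [t] shifted to 0..t-1); a test is a subset T. *)
Definition outcome (t : nat) (S T : {set 'I_t}) : bool := T :&: S != finset.set0.

(* A multistage (adaptive-by-stage) algorithm: given the outcome vectors of
   all previous stages (a list with one entry per completed stage), it
   chooses the list of tests of the next stage. *)
Definition algo (t : nat) := seq (seq bool) -> seq {set 'I_t}.

Fixpoint hist (t : nat) (A : algo t) (S : {set 'I_t}) (k : nat) : seq (seq bool) :=
  match k with
  | 0 => [::]
  | k.+1 => let h := hist A S k in rcons h [seq outcome S T | T <- A h]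
  end.

Fixpoint ntests (t : nat) (A : algo t) (S : {set 'I_t}) (k : nat) : nat :=
  match k with
  | 0 => 0
  | k.+1 => ntests A S k + size (A (hist A S k))
  end.

Definition feasible (p t s n : nat) : Prop :=
  exists A : algo t,
    (exists dec : seq (seq bool) -> {set 'I_t},
        forall S : {set 'I_t}, #|S| = s -> dec (hist A S p) = S) /\
    (forall S : {set 'I_t}, #|S| = s -> ntests A S p <= n).

Lemma feasible_ex_bool p t s :
  (exists n, feasible p t s n) -> exists n, `[< feasible p t s n >].
Proof. by move=> [n Hn]; exists n; apply/asboolP. Qed.

(* N_p(t,s): minimal worst-case number of tests (0 if no p-stage algorithm
   exists, which only happens for p = 0). *)
Definition Ntests (p t s : nat) : nat :=
  match pselect (exists n, feasible p t s n) with
  | left h => ex_minn (feasible_ex_bool h)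
  | right _ => 0
  end.

Definition log2 {R : realType} (x : R) : R := ln x / ln 2.

Definition Cconst (R : realType) (p s : nat) : \bar R :=
  limn_esup (fun t : nat => ((Ntests p t s)%:R / log2 (t%:R : R))%:E).

(* Main.v *)
From HB Require Import structures.
Require Import Defs.
From mathcomp Require Import all_boot all_order all_algebra.
From mathcomp Require Import zify ring lra.
From mathcomp Require Import boolp.
Set Implicit Arguments. Unset Strict Implicit. Unset Printing Implicit Defensive.
Import Order.TTheory GRing.Theory Num.Theory.
Local Open Scope ring_scope.

(** The lower bound is the information bound 2^n >= C(t,3).

For the upper bound, assign to the samples independent random words of length
m ~ 2.9 log2 t and constant weight w, where the density of ones makes each
position of a union of three words equal to 1 with probability 1/2, and let
stage 1 test every position. Given the outcome y (the union of the three
defective words), the candidates form a 3-uniform hypergraph G_y. First moments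
of sunflowers (a core of j vertices and L disjoint petals of size 3 - j) show
that for every y at once:
- j = 1: no vertex has L disjoint pairs completing it to an edge of G_y;
- j = 0: G_y has at most M0^L L-matchings, up to a factor 2^O(m);
- j = 2: two vertices have at most M2 common completions, up to t^o(1);
- M0 M2 <= t^(1/10 + o(1)): large pair degrees occur only for atypical |y|,
  for which there are few matchings.
Stage 2 uses a second random code with log2 M0 tests, which destroys all
L-matchings. A maximal matching then yields a vertex cover of bounded size,
tested vertex by vertex in stage 3; this exposes a defective a. The graph of
pairs completing a has a bounded cover too, tested in stage 4, which exposes a
second defective b. Stage 5 reads the third one in binary among the M2
completions of a and b. The total is 2.9 log2 t + log2 (M0 M2) + o(log2 t),
that is 3 log2 t + o(log2 t).

All moments are bounded by exponential tilting: a word A is given the weight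
v^|A| for a suitable v > 0, so that sums over words factor over positions. *)

(** * Random codes of constant weight *)

Section RandomCode.
Variables (R : realFieldType) (V : finType) (m w : nat).

Definition word := {A : {set 'I_m} | #|A| == w}.
HB.instance Definition _ := Finite.on word.
Notation code := {ffun V -> word}.

Definition union_of (X : code) (P : {set V}) : {set 'I_m} :=
  \bigcup_(v in P) val (X v).

Definition expect (f : code -> R) : R := (\sum_X f X) / #|{: code}|%:R.

Hypothesis le_wm : (w <= m)%N.

Lemma card_word : #|{: word}| = 'C(m, w).
Proof.
rewrite card_sig -[X in 'C(X, _)]card_ord -cardsT -cards_draws -[RHS]sum1_card.
by rewrite -sum1_card; apply: eq_bigl => A; rewrite !inE subsetT.
Qed.

Lemma card_word_gt0 : (0 < #|{: word}|%:R :> R).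
Proof. by rewrite ltr0n card_word bin_gt0. Qed.

Lemma card_code_gt0 : (0 < #|{: code}|%:R :> R).
Proof. by rewrite ltr0n card_ffun expn_gt0 -(ltr0n R) card_word_gt0. Qed.

Lemma eq_expect (f g : code -> R) : f =1 g -> expect f = expect g.
Proof. by move=> fg; rewrite /expect; under eq_bigr do rewrite fg. Qed.

Lemma le_expect (f g : code -> R) :
  (forall X, f X <= g X) -> expect f <= expect g.
Proof.
move=> le_fg; rewrite ler_pM2r ?invr_gt0 ?card_code_gt0 //.
exact: ler_sum.
Qed.

Lemma expect_cst c : expect (fun=> c) = c.
Proof.
rewrite /expect sumr_const -[c *+ _]mulr_natr mulfK //.
by rewrite gt_eqF // card_code_gt0.
Qed.

Lemma expect_sum (I : finType) (P : pred I) (f : I -> code -> R) :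
  expect (fun X => \sum_(i | P i) f i X) = \sum_(i | P i) expect (f i).
Proof. by rewrite /expect exchange_big /= mulr_suml. Qed.

Lemma expectZ c (f : code -> R) : expect (fun X => c * f X) = c * expect f.
Proof. by rewrite /expect -mulr_sumr mulrA. Qed.

Lemma expect_witness (f : code -> R) : exists X, f X <= expect f.
Proof.
have [X0 _] : exists X0 : code, true.
  by have: (0 < #|{: code}|)%N by [rewrite -(ltr0n R) card_code_gt0];
    case/card_gt0P => X0; exists X0.
exists [arg min_(X < X0) f X]%O; case: Order.TotalTheory.arg_minP => // X _ min_X.
rewrite -[leLHS]expect_cst; apply: le_expect => Y; exact: min_X.
Qed.

(* The involution swapping the restrictions to [S] of two independent copies
   preserves the uniform measure, so a function that reads its first argument
   on [S] and its second off [S] cannot tell one copy from two. *)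
Lemma decouple (S : {set V}) (F : code -> code -> R) :
  (forall X X' Y : code, {in S, X =1 X'} -> F X Y = F X' Y) ->
  (forall X Y Y' : code, {in ~: S, Y =1 Y'} -> F X Y = F X Y') ->
  expect (fun X => F X X) = expect (fun X => expect (F X)).
Proof.
move=> F1 F2.
pose mix (X Y : code) : code := [ffun v => if v \in S then X v else Y v].
pose swap (p : code * code) := (mix p.1 p.2, mix p.2 p.1).
have swapK : involutive swap.
  by case=> X Y; rewrite /swap /=; congr (_, _); apply/ffunP => v; rewrite !ffunE; case: (v \in S).
have -> : expect (fun X => expect (F X)) =
    (\sum_(p : code * code) F (swap p).1 (swap p).1) / #|{: code}|%:R / #|{: code}|%:R.
  rewrite /expect -mulr_suml pair_bigA /=; congr (_ / _ / _).
  apply: eq_bigr => -[X Y] _ /=.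
  rewrite (F1 _ (mix X Y)) => [|v vS]; last by rewrite ffunE vS.
  by apply: F2 => v; rewrite inE ffunE => /negPf ->.
have -> : \sum_p F (swap p).1 (swap p).1 = \sum_(p : code * code) F p.1 p.1.
  by rewrite [RHS](reindex_inj (inv_inj swapK)).
rewrite -(pair_bigA _ (fun X _ => F X X)) /=.
under eq_bigr do rewrite sumr_const -[_ *+ _]mulr_natr.
by rewrite -mulr_suml mulfK // gt_eqF // card_code_gt0.
Qed.

Lemma expect_at (a : V) (f : word -> R) :
  expect (fun X => f (X a)) = (\sum_A f A) / #|{: word}|%:R.
Proof.
pose F v A : R := if v == a then f A else 1.
have E (X : code) : f (X a) = \prod_v F v (X v).
  rewrite (bigD1 a) //= /F eqxx big1 ?mulr1 // => v /negPf -> //.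
rewrite /expect; under eq_bigr do rewrite E.
rewrite -(bigA_distr_bigA F) (bigD1 a) //= card_ffun (cardD1 a) inE /= add1n.
have -> : \prod_(v | v != a) \sum_A F v A = #|{: word}|%:R ^+ #|[predD1 V & a]|.
  transitivity (\prod_(v in [predD1 V & a]) (#|{: word}|%:R : R)).
    apply: eq_big => [v|v /negPf va]; first by rewrite !inE andbT.
    by rewrite /F va sumr_const.
  by rewrite prodr_const.
have -> : \sum_A F a A = \sum_A f A by apply: eq_bigr => A _; rewrite /F eqxx.
have := card_word_gt0; rewrite expnS natrM natrX => W_gt0.
by rewrite invfM mulrA mulrAC mulfK // expf_neq0 // gt_eqF.
Qed.

(** The total weight of the [s]-tuples of arbitrary subsets that together with [B] have union [y],
    where a subset [A] weighs [v ^+ #|A|]. A position in [B] is unconstrained and gives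
    [(1 + v) ^+ s]; a position of [y] outside [B] must be hit at least once, which removes the term
    1. *)
Definition tilt (v : R) (s : nat) (B y : {set 'I_m}) : R :=
  if B \subset y
  then ((1 + v) ^+ s) ^+ #|B| * ((1 + v) ^+ s - 1) ^+ #|y :\: B| else 0.

(** Both sides factor over the positions, so adding one more word is checked position by
    position. *)
Lemma tilt_step (v : R) s (B y : {set 'I_m}) :
  \sum_(A : {set 'I_m}) v ^+ #|A| * tilt v s (B :|: A) y = tilt v s.+1 B y.
Proof.
pose al := (1 + v) ^+ s; pose ga := al - 1.
(* [F i] and [G i] are the factors of position [i] when it lies in the new word and when it does
   not. *)
pose F (i : 'I_m) := if i \in y then v * al else 0.
pose G (i : 'I_m) := if i \in y then (if i \in B then al else ga)
                     else (if i \in B then 0 else 1).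
have prodE (C D : {set 'I_m}) a : \prod_i (if i \in C then a else 1 : R) = a ^+ #|C|.
  by rewrite -big_mkcond prodr_const.
transitivity (\sum_(A : {set 'I_m}) \prod_i (if i \in A then F i else G i)).
  apply: eq_bigr => A _; rewrite /tilt.
  case: ifPn => [/subsetP sub|/subsetPn[i iBA iy]]; last first.
    rewrite mulr0 (bigD1 i) //= /F /G (negPf iy).
    move: iBA; rewrite inE; case: (i \in A); first by rewrite mul0r.
    by rewrite orbF => ->; rewrite mul0r.
  rewrite -!prodE -/al -/ga // -!big_split /=; apply: eq_bigr => i _.
  have := sub i; rewrite /F /G !inE.
  case: (i \in A); case: (i \in B); case: (i \in y) => //= h;
    rewrite ?mulr1 ?mul1r //; by have := h isT.
rewrite -(bigA_distr _ _ F G) /tilt /=.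
case: ifPn => [/subsetP sub|/subsetPn[i iB iy]]; last first.
  by rewrite (bigD1 i) //= /F /G iB (negPf iy) addr0 mul0r.
rewrite -!prodE // -!big_split /=; apply: eq_bigr => i _.
have := sub i; rewrite /F /G /ga /al !inE exprS.
case: (i \in B); case: (i \in y) => //= h; first by ring.
- by have := h isT.
- by ring.
- by rewrite add0r mulr1.
Qed.

Lemma tilt_ge0 v s B y : 0 <= v -> 0 <= tilt v s B y.
Proof.
move=> v0; rewrite /tilt; case: ifP => // _.
have ge1 : 1 <= (1 + v) ^+ s by apply: exprn_ege1; rewrite lerDl.
by rewrite mulr_ge0 // exprn_ge0 // ?subr_ge0 // (le_trans ler01).
Qed.

Lemma union_of_eq (X Y : code) (P : {set V}) : {in P, X =1 Y} -> union_of X P = union_of Y P.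
Proof. by move=> XY; apply: eq_bigr => v vP; rewrite XY. Qed.

(** Every word has the same tilted weight [v ^+ w], so its probability is this weight divided by
    [v ^+ w * #|{: word}|]. Letting the words range over all subsets then only increases the sum,
    and [tilt] evaluates it. The choice of [v] is left free. *)
Lemma expect_petal (v : R) (P : {set V}) (B y : {set 'I_m}) : 0 < v ->
  expect (fun X => (B :|: union_of X P == y)%:R)
    <= tilt v #|P| B y / (v ^+ w * #|{: word}|%:R) ^+ #|P|.
Proof.
move=> v0; move: {2}#|P| (erefl #|P|) => s; elim: s P B => [|s IHs] P B sP.
  rewrite sP expr0 divr1.
  have -> : P = finset.set0 by apply: cards0_eq.
  rewrite -[leRHS]expect_cst; apply: le_expect => X.
  rewrite /union_of big_set0 setU0 /tilt !expr0 expr1n subrr.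
  case: eqP => [->|neq]; last by case: ifP => // _; rewrite mul1r exprn_ge0.
  by rewrite subxx setDv cards0 mul1r expr0.
have /card_gt0P[a aP] : (0 < #|P|)%N by rewrite sP.
have sP' : #|P :\ a| = s by move: sP; rewrite (cardsD1 a) aP => -[].
(* [F] reads the word of [a] from one copy and the other words of [P] from an independent one. *)
pose F (X Y : code) : R := (B :|: val (X a) :|: union_of Y (P :\ a) == y)%:R.
rewrite (eq_expect (g := fun X => F X X)); last first.
  by move=> X; congr (_ == _)%:R; rewrite {1}/union_of (big_setD1 a) //= setUA.
rewrite (@decouple [set a]) => [|X X' Y XX'|X Y Y' YY']; first 1 last.
- by rewrite /F XX' // inE.
- rewrite /F (@union_of_eq Y Y') // => u; rewrite !inE => /andP[ua _].
  by apply: YY'; rewrite !inE.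
pose c := v ^+ w * #|{: word}|%:R.
have c0 : 0 < c by rewrite mulr_gt0 ?exprn_gt0 // card_word_gt0.
apply: le_trans (le_expect (g := fun X => tilt v s (B :|: val (X a)) y / c ^+ s) _) _.
  by move=> X; rewrite -sP'; apply: IHs.
rewrite (expect_at a (fun A : word => tilt v s (B :|: val A) y / c ^+ s)) -mulr_suml.
rewrite sP exprS -/c [(c * _)^-1]invfM [leLHS]mulrAC [leRHS]mulrA.
rewrite ler_pM2r ?invr_gt0 ?exprn_gt0 //.
rewrite /c [(_ * _)^-1]invfM [leRHS]mulrA ler_pM2r ?invr_gt0 ?card_word_gt0 //.
rewrite [leRHS]mulrC ler_pdivlMl ?exprn_gt0 // mulr_sumr -tilt_step.
(* Subsets of size other than [w] contribute nonnegative terms, which are dropped. *)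
rewrite [leRHS](bigID (fun A : {set 'I_m} => #|A| == w)) /=.
rewrite -[leLHS]addr0 lerD ?sumr_ge0 //; last first.
  by move=> A _; rewrite mulr_ge0 ?exprn_ge0 ?tilt_ge0 // ltW.
rewrite (reindex_omap (val : word -> _) insub) => [|A Aw]; last by rewrite insubT.
rewrite le_eqVlt; apply/orP; left; apply/eqP; apply: eq_big => [A|A _].
  by rewrite valK eqxx (valP A).
by rewrite (eqP (valP A)).
Qed.

(** * Sunflowers in a random code *)

Definition disj : rel {set V} := fun P Q => [disjoint P & Q].

(** Disjoint petals carry independent words, so their probabilities multiply. *)
Lemma expect_petals q (s : seq {set V}) (B y : {set 'I_m}) : 0 <= q ->
  pairwise disj s ->
  {in s, forall P, expect (fun X => (B :|: union_of X P == y)%:R) <= q} ->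
  expect (fun X => (all (fun P => B :|: union_of X P == y) s)%:R) <= q ^+ size s.
Proof.
move=> q0; elim: s => [|P s IHs] /=; first by rewrite expect_cst.
case/andP => /allP Ps dis_s le_q.
pose F (X Y : code) : R :=
  (B :|: union_of X P == y)%:R * (all (fun P => B :|: union_of Y P == y) s)%:R.
rewrite (eq_expect (g := fun X => F X X)); last first.
  by move=> X; rewrite /F -natrM mulnb.
rewrite (@decouple P) => [|X X' Y XX'|X Y Y' YY']; first 1 last.
- by rewrite /F (union_of_eq XX').
- rewrite /F; congr (_ * _%:R); congr nat_of_bool; apply: eq_in_all => Q Qs.
  rewrite (@union_of_eq Y Y') // => v vQ; apply: YY'; rewrite inE.
  by have := Ps _ Qs; rewrite /disj disjoint_sym => /disjointFr ->.
have bound_ge0 : 0 <= q ^+ size s by rewrite exprn_ge0.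
apply: (@le_trans _ _ (expect (fun X => q ^+ size s * (B :|: union_of X P == y)%:R))).
  apply: le_expect => X; rewrite /F expectZ mulrC ler_wpM2r ?ler0n //.
  by apply: IHs => // Q Qs; apply: le_q; rewrite inE Qs orbT.
by rewrite expectZ exprS mulrC ler_wpM2r // le_q // inE eqxx.
Qed.

(** The petals are independent once the words of the core are frozen as [X0]; hence [q] has to be a
    bound for every choice of core words. *)
Lemma expect_sunflower q (K : {set V}) s (y : {set 'I_m}) : 0 <= q ->
  pairwise disj (K :: s) ->
  (forall X0 : code, {in s, forall P,
    expect (fun X => (union_of X0 K :|: union_of X P == y)%:R) <= q}) ->
  expect (fun X => (all (fun P => union_of X (K :|: P) == y) s)%:R) <= q ^+ size s.
Proof.
move=> q0 /=; case/andP => /allP Ks dis_s le_q.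
pose F (X Y : code) : R := (all (fun P => union_of X K :|: union_of Y P == y) s)%:R.
rewrite (eq_expect (g := fun X => F X X)); last first.
  move=> X; rewrite /F; congr (nat_of_bool _)%:R; apply: eq_in_all => P Ps.
  by rewrite {1}/union_of bigcup_setU.
rewrite (@decouple K) => [|X X' Y XX'|X Y Y' YY']; first 1 last.
- by rewrite /F (union_of_eq XX').
- rewrite /F; congr (nat_of_bool _)%:R; apply: eq_in_all => Q Qs.
  rewrite (@union_of_eq Y Y') // => v vQ; apply: YY'; rewrite inE.
  by have := Ks _ Qs; rewrite /disj disjoint_sym => /disjointFr ->.
rewrite -[leRHS]expect_cst; apply: le_expect => X0.
by apply: expect_petals => //; apply: le_q.
Qed.

Lemma card_all_tuple (U : finType) (A : {set U}) L :
  #|[set s : L.-tuple U | all (mem A) s]| = (#|A| ^ L)%N.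
Proof.
have <- : #|[set f : {ffun 'I_L -> U} | f \in ffun_on A]| = (#|A| ^ L)%N.
  by rewrite cardsE card_ffun_on card_ord.
rewrite -(card_imset _ (can_inj (@finfun_of_tupleK U L))).
apply: eq_card => f; rewrite !inE; apply/imsetP/ffun_onP => [[s] | fA].
  by rewrite inE => /allP sA -> i; rewrite ffunE; apply: sA; rewrite mem_tnth.
exists (tuple_of_finfun f); last by rewrite tuple_of_finfunK.
by rewrite inE; apply/allP => _ /tnthP[i ->]; rewrite tnth_map tnth_ord_tuple; apply: fA.
Qed.

Lemma leq_expl a b k : (a <= b)%N -> (a ^ k <= b ^ k)%N.
Proof. by case: k => // k; rewrite leq_exp2r. Qed.

Lemma leq_bin_exp n k : ('C(n, k) <= n ^ k)%N.
Proof.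
elim: n k => [|n IHn] [|k] //=; rewrite binS.
apply: leq_trans (leq_add (IHn _) (IHn _)) _.
by rewrite expnS -mulSnr expnS leq_mul // leq_expl.
Qed.

(** The petals form an ordered tuple, which bounds the number of shapes by a plain product of
    powers. *)
Definition sunflowers (X : code) (y : {set 'I_m}) j L :=
  [set p : {set V} * L.-tuple {set V} |
    [&& #|p.1| == j, all (fun P : {set V} => #|P| == (3 - j)%N) p.2,
        pairwise disj (p.1 :: p.2) &
        all (fun P => union_of X (p.1 :|: P) == y) p.2]].

Lemma expect_sunflowers q (y : {set 'I_m}) j L (T : nat) : 0 <= q ->
  (#|V| <= T)%N ->
  (forall (X0 : code) (K P : {set V}), #|K| = j -> #|P| = (3 - j)%N ->
    expect (fun X => (union_of X0 K :|: union_of X P == y)%:R) <= q) ->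
  expect (fun X => #|sunflowers X y j L|%:R) <= T%:R ^+ j * (T%:R ^+ (3 - j) * q) ^+ L.
Proof.
move=> q0 leVT le_q.
pose shapes := [set p : {set V} * L.-tuple {set V} |
    [&& #|p.1| == j, all (fun P : {set V} => #|P| == (3 - j)%N) p.2 &
        pairwise disj (p.1 :: p.2)]].
rewrite (eq_expect (g := fun X => \sum_(p in shapes)
    (all (fun P => union_of X (p.1 :|: P) == y) p.2)%:R)); last first.
  move=> X; rewrite -sum1_card natr_sum [LHS]big_mkcond [RHS]big_mkcond /=.
  apply: eq_bigr => p _; rewrite !inE !andbA.
  by case: (_ && pairwise _ _); case: (all (fun P => union_of X _ == y) p.2).
rewrite expect_sum.
have card_shapes : (#|shapes| <= T ^ j * (T ^ (3 - j)) ^ L)%N.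
  have le_draws i : (#|[set K : {set V} | #|K| == i]| <= T ^ i)%N.
    rewrite -(@eq_card _ [set K : {set V} | K \subset [set: V] & #|K| == i]).
      by rewrite cards_draws cardsT (leq_trans (leq_bin_exp _ _)) // leq_expl.
    by move=> K; rewrite !inE subsetT.
  pose D i := [set K : {set V} | #|K| == i].
  apply: (@leq_trans #|setX (D j) [set s : L.-tuple _ | all (mem (D (3 - j)%N)) s]|).
    apply: subset_leq_card; apply/subsetP => -[K s]; rewrite !inE /=.
    case/and3P => -> /allP sP _ /=; apply/allP => P /sP cP.
    by change (P \in D (3 - j)%N); rewrite inE.
  by rewrite cardsX card_all_tuple leq_mul ?leq_expl // le_draws.
apply: (@le_trans _ _ (\sum_(p in shapes) q ^+ L)).
  apply: ler_sum => -[K s]; rewrite inE /= => /and3P[/eqP cK /allP cs dis_s].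
  rewrite -[X in q ^+ X](size_tuple s); apply: expect_sunflower => // X0 P Ps.
  by apply: le_q => //; apply/eqP/cs.
rewrite sumr_const -[q ^+ L *+ _]mulr_natl exprMn mulrA ler_wpM2r ?exprn_ge0 //.
by rewrite -!natrX -natrM ler_nat.
Qed.

(** First moment method for all [j] and [y] at once: each count is divided by the bound on its mean,
    so the sum over three values of [j] and [2 ^ m] values of [y] has mean at most [3 * 2 ^+ m], and
    some code does no worse than the mean. *)
Lemma exists_code (q : nat -> {set 'I_m} -> R) L (T : nat) : (0 < T)%N ->
  (#|V| <= T)%N ->
  (forall j y, 0 < q j y) ->
  (forall (X0 : code) (K P : {set V}) y, (#|K| < 3)%N -> #|P| = (3 - #|K|)%N ->
    expect (fun X => (union_of X0 K :|: union_of X P == y)%:R) <= q #|K| y) ->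
  exists X : code, forall j y, (j < 3)%N ->
    #|sunflowers X y j L|%:R <=
      3 * 2 ^+ m * (T%:R ^+ j * (T%:R ^+ (3 - j) * q j y) ^+ L).
Proof.
move=> T0 leVT q0 le_q.
pose beta j y := T%:R ^+ j * (T%:R ^+ (3 - j) * q j y) ^+ L.
have T0R : 0 < T%:R :> R by rewrite ltr0n.
have beta0 j y : 0 < beta j y by rewrite !(mulr_gt0, exprn_gt0).
pose f X := \sum_(j < 3) \sum_(y : {set 'I_m}) (beta j y)^-1 * #|sunflowers X y j L|%:R.
have [X leX] := expect_witness f; exists X => j y j3.
have {}leX : f X <= 3 * 2 ^+ m.
  apply: le_trans leX _; rewrite /f expect_sum.
  apply: (@le_trans _ _ (\sum_(i < 3) \sum_(z : {set 'I_m}) 1)).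
    apply: ler_sum => i _; rewrite expect_sum; apply: ler_sum => z _.
    rewrite expectZ ler_pdivrMl ?beta0 // mulr1; apply: expect_sunflowers => //.
      exact: ltW.
    by move=> X0 K P cK cP; have := le_q X0 K P z; rewrite cK; apply.
  under eq_bigr do rewrite sumr_const.
  rewrite sumr_const !card_ord -mulrnA mulnC natrM.
  have -> : #|{: {set 'I_m}}| = (2 ^ m)%N.
    by rewrite -cardsT -powersetT card_powerset cardsT card_ord.
  by rewrite natrX.
rewrite -/(beta j y) -ler_pdivrMr ?beta0 //; apply: le_trans leX.
have term_ge0 (i : 'I_3) z : 0 <= (beta i z)^-1 * #|sunflowers X z i L|%:R.
  by rewrite mulr_ge0 ?ler0n // invr_ge0 ltW.
rewrite /f (bigD1 (Ordinal j3)) //= (bigD1 y) //= mulrC -addrA lerDl addr_ge0 //.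
  by apply: sumr_ge0 => z _; apply: (term_ge0 (Ordinal j3)).
by apply: sumr_ge0 => i _; apply: sumr_ge0 => z _; apply: term_ge0.
Qed.

End RandomCode.

(** * Strategies *)

Section Strategies.
Local Open Scope nat_scope.
Variable t : nat.
Implicit Types (H : {set {set 'I_t}}) (S : {set 'I_t}) (ts : seq {set 'I_t}).

Definition outcomes ts S := [seq outcome S T | T <- ts].

(** Recursion over the decision tree, with [n] the remaining budget. A vector [o] that no candidate
    produces leaves an empty class, which is harmless. *)
Fixpoint solvable p H n : Prop :=
  if p is p'.+1 then
    exists2 ts, (size ts <= n)%N &
      forall o, solvable p' [set S in H | outcomes ts S == o] (n - size ts)
  else (#|H| <= 1)%N.

Lemma histS (A : algo t) S k :
  hist A S k.+1 = rcons (hist A S k) (outcomes (A (hist A S k)) S).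
Proof. by []. Qed.

Lemma ntestsS (A : algo t) S k :
  ntests A S k.+1 = ntests A S k + size (A (hist A S k)).
Proof. by []. Qed.

Lemma hist_shift (A : algo t) S k :
  hist A S k.+1 = outcomes (A [::]) S :: hist (fun h => A (outcomes (A [::]) S :: h)) S k.
Proof. by elim: k => [|k IHk] //; rewrite histS IHk. Qed.

Lemma ntests_shift (A : algo t) S k :
  ntests A S k.+1 =
    (size (A [::]) + ntests (fun h => A (outcomes (A [::]) S :: h)) S k)%N.
Proof.
elim: k => [|k IHk]; first by rewrite /= add0n addn0.
by rewrite ntestsS IHk hist_shift ntestsS addnA.
Qed.

(** Strategies for all outcomes of the first stage are chosen at once and glued: the head of the
    history selects the one to follow. *)
Lemma solvable_algo p H n : solvable p H n ->
  exists Ad : algo t * (seq (seq bool) -> {set 'I_t}), {in H, forall S,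
    Ad.2 (hist Ad.1 S p) = S /\ (ntests Ad.1 S p <= n)%N}.
Proof.
elim: p H n => [|p IHp] H n /=.
  move=> H1; exists (fun=> [::], fun=> odflt finset.set0 [pick S in H]) => S SH /=.
  split=> //; case: pickP => [S' S'H|/(_ S)]; last by rewrite SH.
  by apply/esym; move/card_le1_eqP: H1; apply.
case=> ts ts_n sol.
have [Ad Ad_ok] := choice (fun o => IHp _ _ (sol o)).
pose A : algo t := fun h => if h is o :: h' then (Ad o).1 h' else ts.
pose dec h := if h is o :: h' then (Ad o).2 h' else finset.set0.
exists (A, dec) => S SH; change (dec (hist A S p.+1) = S /\ ntests A S p.+1 <= n).
have SHo : S \in [set S' in H | outcomes ts S' == outcomes ts S] by rewrite inE SH /=.
have [decS ntS] := Ad_ok (outcomes ts S) S SHo.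
rewrite hist_shift ntests_shift; split; first exact: decS.
by rewrite -(subnKC ts_n) leq_add2l.
Qed.

Lemma solvable_feasible p s n :
  solvable p [set S : {set 'I_t} | #|S| == s] n -> feasible p t s n.
Proof.
case/solvable_algo => -[A dec] ok; exists A; split.
  by exists dec => S /eqP Ss; case: (ok S) => //; rewrite inE.
by move=> S /eqP Ss; case: (ok S) => //; rewrite inE.
Qed.

Lemma solvable_sub p H H' n : H' \subset H -> solvable p H n -> solvable p H' n.
Proof.
elim: p H H' n => [|p IHp] H H' n sub /=; first exact: leq_trans (subset_leq_card sub).
case=> ts ts_n sol; exists ts => // o; apply: IHp (sol o).
by apply/subsetP => S; rewrite !inE => /andP[/(subsetP sub) -> ->].
Qed.

Lemma solvable_leq p H n n' : (n <= n')%N -> solvable p H n -> solvable p H n'.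
Proof.
elim: p H n n' => [|p IHp] H n n' le_n //= [ts ts_n sol].
exists ts; first exact: leq_trans le_n.
by move=> o; apply: IHp (sol o); rewrite leq_sub2r.
Qed.

Lemma solvable_set0 p n : solvable p finset.set0 n.
Proof.
elim: p n => [|p IHp] n /=; first by rewrite cards0.
exists [::] => // o; rewrite subn0; apply: solvable_sub (IHp n).
by apply/subsetP => S; rewrite !inE.
Qed.

(** The members of [C] are tested individually in one stage. Every candidate meets [C], so some test
    is positive, and all survivors contain the member it exposes. *)
Lemma solvable_cover p H (C : {set 'I_t}) n :
  {in H, forall S, C :&: S != finset.set0} ->
  {in C, forall v, solvable p [set S in H | v \in S] n} ->
  solvable p.+1 H (#|C| + n).
Proof.
move=> HC sol; pose ts := [seq [set v] | v <- enum C].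
have size_ts : size ts = #|C| by rewrite size_map cardE.
exists ts => [|o]; rewrite size_ts ?leq_addr // addKn.
have [->|[S0]] := set_0Vmem [set S in H | outcomes ts S == o].
  exact: solvable_set0.
rewrite inE => /andP[S0H /eqP o_S0]; have /set0Pn[v] := HC _ S0H.
rewrite inE => /andP[vC vS0]; apply: solvable_sub (sol v vC).
apply/subsetP => S; rewrite !inE => /andP[-> /eqP]; rewrite -o_S0 /outcomes -!map_comp.
move=> /eq_in_map /(_ v); rewrite mem_enum vC => /(_ isT) /= E.
have outE S' : outcome S' [set v] = (v \in S').
  apply/set0Pn/idP => [[u]|vS']; last by exists v; rewrite !inE eqxx.
  by rewrite !inE => /andP[/eqP ->].
by rewrite -outE E outE.
Qed.

(** Only one element outside the known set [K] is missing, and it is read in binary: test [j]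
    collects the possible elements whose code has bit [j]. Elements of [K] are kept out, as they
    would force a positive outcome. *)
Lemma solvable_bits H (K : {set 'I_t}) q : (#|H| <= 2 ^ q)%N ->
  {in H, forall S, K \subset S /\ #|S :\: K| = 1%N} -> solvable 1 H q.
Proof.
(* The rank of [S] in [H] indexes the list of the [2 ^ q] subsets of ['I_q], which serve as bit
   strings; the bound on [#|H|] keeps the index in range. *)
move=> H_q HK; pose code S := nth finset.set0 (enum {set 'I_q}) (index S (enum H)).
have code_inj : {in H &, injective code}.
  move=> S S' SH S'H.
  have lt_idx S'' : S'' \in H -> index S'' (enum H) < size (enum {set 'I_q}).
    move=> S''H; rewrite -cardE -cardsT -powersetT card_powerset cardsT card_ord.
    by apply: leq_trans H_q; rewrite cardE index_mem mem_enum.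
  move=> /eqP; rewrite nth_uniq ?enum_uniq ?lt_idx // => /eqP idx.
  by rewrite -[S](@nth_index _ S _ (enum H)) ?mem_enum // idx nth_index ?mem_enum.
pose T (j : 'I_q) := [set c | (c \notin K) && (j \in code (c |: K))].
have outE S j : S \in H -> outcome S (T j) = (j \in code S).
  move=> SH; have [KS] := HK _ SH; move/eqP/cards1P => [c cS].
  have Sc : S = c |: K by rewrite -[LHS](setID S K) cS (setIidPr KS) setUC.
  apply/set0Pn/idP => [[u]|jS].
    rewrite !inE => /andP[/andP[uK ju] uS].
    have : u \in S :\: K by rewrite inE uK.
    by rewrite cS inE => /eqP uc; rewrite Sc -uc.
  exists c; have : c \in S :\: K by rewrite cS inE.
  by rewrite !inE -Sc jS => /andP[-> ->].
exists [seq T j | j <- enum 'I_q]; first by rewrite size_map size_enum_ord.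
move=> o /=; apply/card_le1_eqP => S S'; rewrite !inE.
move=> /andP[SH /eqP oS] /andP[S'H /eqP oS']; apply: code_inj => //; apply/setP => j.
have E S0 : outcomes [seq T i | i <- enum 'I_q] S0 = [seq outcome S0 (T i) | i <- enum 'I_q].
  by rewrite /outcomes -map_comp.
move: oS; rewrite -oS' !E => /eq_in_map /(_ j).
by rewrite mem_enum => /(_ isT) /=; rewrite !outE.
Qed.
End Strategies.

(** * Vertex covers from maximal matchings *)

Section Covers.
Local Open Scope nat_scope.
Variable V : finType.

(** The cover is the union of a maximal matching [M], which has at most [L] edges of at most [s]
    vertices each. Inclusion in [cover H] is recorded so that a cover of the link of a vertex avoids
    that vertex. *)
Lemma cover_of_matching (H : {set {set V}}) L s :
  (forall M : seq {set V}, size M = L -> {subset M <= H} -> ~~ pairwise (@disj V) M) ->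
  {in H, forall e : {set V}, (0 < #|e| <= s)%N} ->
  exists C : {set V}, [/\ (#|C| <= L * s)%N, C \subset cover H &
    {in H, forall e : {set V}, C :&: e != finset.set0}].
Proof.
move=> noM He.
pose P (M : {set {set V}}) := (M \subset H) && trivIset M.
have [M maxM _] : {M | maxset P M & finset.set0 \subset M}.
  by apply: maxset_exists; rewrite /P sub0set; apply/trivIsetP => A B; rewrite inE.
have /andP[MH trivM] := maxsetp maxM.
exists (cover M); split.
- have ltML : (#|M| <= L)%N.
    rewrite leqNgt; apply/negP => ltLM.
    have := noM (take L (enum M)); rewrite size_take -cardE ltLM => /(_ erefl).
    have sub : {subset take L (enum M) <= H}.
      by move=> e /mem_take; rewrite mem_enum => /(subsetP MH).
    move=> /(_ sub) /negP; apply.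
    apply: (@subseq_pairwise _ _ _ (enum M)).
      by rewrite -{2}(cat_take_drop L (enum M)) prefix_subseq.
    have := enum_uniq M; rewrite uniq_pairwise.
    apply: sub_in_pairwise (allss _) => A B; rewrite !mem_enum => AM BM /=.
    by move/trivIsetP: trivM; apply.
  apply: leq_trans (leq_mul ltML (leqnn s)).
  rewrite -sum_nat_const; apply: leq_trans (leq_card_cover M) _.
  by apply: leq_sum => e eM; have /andP[] := He _ (subsetP MH _ eM).
- by apply/bigcupsP => e eM; apply: bigcup_sup; apply: (subsetP MH).
(* An edge missed by the cover could be added to [M], so by maximality it lies in [M]; it is then
   disjoint from itself, hence empty. *)
- move=> e eH; apply: contraTneq isT => dis.
  have /andP[/card_gt0P[x xe] _] := He _ eH.
  have disM A : A \in M -> [disjoint e & A].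
    move=> AM; rewrite -setI_eq0 -subset0 -dis setIC setSI //.
    exact: bigcup_sup.
  have PM : P (e |: M).
    rewrite /P subUset sub1set eH MH; apply/trivIsetP => A B.
    rewrite !inE => /predU1P[->|AM] /predU1P[->|BM] neq.
    + by rewrite eqxx in neq.
    + exact: disM.
    + by rewrite disjoint_sym disM.
    + by move/trivIsetP: trivM; apply.
  have eM : e \in M by rewrite -(maxsetsup maxM PM (subsetUr _ _)) setU11.
  have := disM _ eM; rewrite -setI_eq0 setIid => /eqP e0.
  by rewrite e0 inE in xe.
Qed.
End Covers.

(** * Stages driven by a code *)

Section CodeStages.
Variable t : nat.
Implicit Types (H : {set {set 'I_t}}) (S : {set 'I_t}).

Definition code_tests m w (X : {ffun 'I_t -> word m w}) : seq {set 'I_t} :=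
  [seq [set v | i \in val (X v)] | i <- enum 'I_m].

Lemma solvable_code m w (X : {ffun 'I_t -> word m w}) p H n :
  (forall y, solvable p [set S in H | union_of X S == y] n) ->
  solvable p.+1 H (m + n)%N.
Proof.
move=> sol; have size_ts : size (code_tests X) = m by rewrite size_map size_enum_ord.
exists (code_tests X) => [|o]; rewrite size_ts ?leq_addr // addKn.
have [->|[S0]] := set_0Vmem [set S in H | outcomes (code_tests X) S == o].
  exact: solvable_set0.
rewrite inE => /andP[S0H /eqP o_S0]; apply: solvable_sub (sol (union_of X S0)).
apply/subsetP => S; rewrite !inE => /andP[-> /eqP] /=.
have E S' : outcomes (code_tests X) S' = [seq i \in union_of X S' | i <- enum 'I_m].
  rewrite /outcomes /code_tests -map_comp; apply: eq_map => i /=.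
  apply/set0Pn/bigcupP => [[v]|[v vS' iv]]; first by rewrite !inE => /andP[]; exists v.
  by exists v; rewrite !inE iv.
rewrite -o_S0 !E => /eq_in_map eqU; apply/eqP/setP => i.
by apply: eqU; rewrite mem_enum.
Qed.

(** Stages 3, 4 and 5, which cost [L * 3], [L * 2] and [q] tests. *)
Lemma solvable_triples H L q :
  {in H, forall S, #|S| = 3} ->
  (forall M : seq {set 'I_t}, size M = L -> {subset M <= H} ->
     ~~ pairwise (@disj _) M) ->
  (forall a (M : seq {set 'I_t}), size M = L -> all (fun P : {set _} => a \notin P) M ->
     {subset [seq a |: P | P <- M] <= H} -> ~~ pairwise (@disj _) M) ->
  (forall a b, a != b -> #|[set S in H | (a \in S) && (b \in S)]| <= 2 ^ q)%N ->
  solvable 3 H (L * 3 + (L * 2 + q))%N.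
Proof.
move=> H3 noM noL cap.
have [|C1 [C1_L _ HC1]] := @cover_of_matching _ H L 3 noM.
  by move=> S /H3 ->.
apply: solvable_leq (solvable_cover (n := (L * 2 + q)%N) _ _).
- by rewrite leq_add2r; apply: C1_L.
- exact: HC1.
(* [Ha] is the link graph of the exposed defective [a]. *)
move=> a aC1; pose Ha := [set P : {set 'I_t} | (a \notin P) && (a |: P \in H)].
have Ha2 : {in Ha, forall P : {set 'I_t}, #|P| = 2}.
  by move=> P; rewrite inE => /andP[aP /H3]; rewrite cardsU1 aP => -[].
have [||C2 [C2_L C2a HC2]] := @cover_of_matching _ Ha L 2.
- move=> M sM MHa; apply: (noL a) => //.
    by apply/allP => P /MHa; rewrite inE => /andP[].
  by move=> _ /mapP[P PM ->]; have := MHa _ PM; rewrite inE => /andP[].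
- by move=> P /Ha2 ->.
(* Vertices of the link differ from [a], so stage 4 exposes a new defective. *)
have aC2 : a \notin C2.
  apply/negP => /(subsetP C2a) /bigcupP[P]; rewrite inE => /andP[aP _].
  by rewrite (negPf aP).
apply: solvable_leq (solvable_cover (n := q) _ _).
- by rewrite leq_add2r; apply: C2_L.
- move=> S; rewrite inE => /andP[SH aS].
  have : S :\ a \in Ha by rewrite !inE eqxx /= setD1K.
  move=> /HC2; apply: contra_neq => CS0; apply/eqP.
  by rewrite -subset0 -CS0 setIS // subD1set.
move=> b bC2; have ab : a != b by apply: contraNneq aC2 => ->.
apply: (@solvable_bits _ _ [set a; b]).
  apply: leq_trans (cap a b ab); apply: subset_leq_card; apply/subsetP => S.
  by rewrite !inE -andbA.
move=> S; rewrite !inE => /andP[/andP[/H3 S3 aS] bS].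
have sub : [set a; b] \subset S by apply/subsetP => v; rewrite !inE => /orP[] /eqP ->.
by split=> //; rewrite cardsD (setIidPr sub) S3 cards2 ab.
Qed.

(** [L] disjoint pairs in the link of [a] are the petals of a sunflower with core [[set a]]. *)
Lemma no_link_matching m w (X : {ffun 'I_t -> word m w}) y L a (M : seq {set 'I_t}) :
  #|sunflowers X y 1 L| = 0%N -> size M = L -> all (fun P : {set _} => a \notin P) M ->
  {subset [seq a |: P | P <- M] <= [set S : {set 'I_t} | (#|S| == 3) && (union_of X S == y)]} ->
  ~~ pairwise (@disj _) M.
Proof.
move=> /eqP; rewrite cards_eq0 => /eqP no_sun sM aM MH; apply/negP => dM.
have : ([set a], tcast sM (in_tuple M)) \in sunflowers X y 1 L.
  have M_ok P : P \in M -> (a \notin P) && (#|a |: P| == 3) && (union_of X (a |: P) == y).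
    move=> PM; have := MH (a |: P); rewrite inE map_f // => /(_ isT) /andP[-> ->].
    by rewrite (allP aM).
  rewrite inE cards1 eqxx /= val_tcast /= dM andbT.
  apply/and3P; split; apply/allP => P /M_ok /andP[/andP[aP P3] Py] //.
    by move: P3; rewrite cardsU1 aP.
  by rewrite /disj disjoints1.
by rewrite no_sun inE.
Qed.

(** Each ordered choice of [L] distinct completions of [a] and [b] gives a sunflower with core
    [[set a; b]] and singleton petals; the falling factorial counts these choices. *)
Lemma card_completions m w (X : {ffun 'I_t -> word m w}) y L a b : a != b ->
  (#|[set S : {set 'I_t} | (#|S| == 3) && (union_of X S == y) & (a \in S) && (b \in S)]| ^_ L
     <= #|sunflowers X y 2 L|)%N.
Proof.
move=> ab; set F := [set S | _ & _].
pose N := [set c : 'I_t | (c \notin [set a; b]) && (c |: [set a; b] \in F)].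
have -> : #|F| = #|N|.
  rewrite -(@card_in_imset _ _ (fun c => c |: [set a; b]) N).
    apply: eq_card => S; apply/idP/imsetP => [SF|[c]]; last by rewrite inE => /andP[_ ?] ->.
    have := SF; rewrite inE => /andP[/andP[/eqP S3 _] /andP[aS bS]].
    have sub : [set a; b] \subset S by apply/subsetP => v; rewrite !inE => /orP[] /eqP ->.
    have : #|S :\: [set a; b]| == 1%N by rewrite cardsD (setIidPr sub) S3 cards2 ab.
    case/cards1P => c Sc; have E : S = c |: [set a; b].
      by rewrite -[LHS](setID S [set a; b]) (setIidPr sub) Sc setUC.
    exists c => //; rewrite inE -E SF andbT.
    by have : c \in S :\: [set a; b] by [rewrite Sc inE]; rewrite inE => /andP[].
  move=> c d; rewrite !inE => /andP[cab _] /andP[dab _] /setP /(_ c).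
  by rewrite !inE eqxx (negPf cab) !orbF => /esym/eqP.
apply: (@leq_trans #|[set s : L.-tuple _ | all (mem N) s & uniq s]|).
  by rewrite card_uniq_tuples.
pose f (s : L.-tuple 'I_t) := ([set a; b], [tuple of map (fun c => [set c]) s]).
rewrite -(@card_imset _ _ f) => [|s s' /(congr1 snd) /(congr1 val) /= E]; last first.
  by apply/val_inj/(inj_map (@set1_inj _)).
apply: subset_leq_card; apply/subsetP => _ /imsetP[s + ->].
rewrite !inE /= cards2 ab eqxx /= => /andP[/allP sN us].
have sF c : c \in s -> (c \notin [set a; b]) && (union_of X (c |: [set a; b]) == y).
  by move=> /sN; rewrite !inE => /andP[-> /andP[/andP[_ ->]]].
rewrite !all_map -[in X in _ && X]andbA; apply/and4P; split.
- by apply/allP => c _; rewrite /= cards1.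
- by apply/allP => c /sF /andP[cab _]; rewrite /= /disj disjoint_sym disjoints1.
- rewrite pairwise_map; apply: sub_pairwise (_ : pairwise [rel c d | c != d] s).
    by move=> c d cd; rewrite /= /disj disjoints1 inE.
  by rewrite -uniq_pairwise.
- by apply/allP => c /sF /andP[_ cy]; rewrite /= setUC.
Qed.

Definition matchings H L := [set s : L.-tuple {set 'I_t} |
  all (mem H) s && pairwise (@disj _) s].

(** A matching is a sunflower with empty core. *)
Lemma card_matchings m w (X : {ffun 'I_t -> word m w}) y L :
  (#|matchings [set S : {set 'I_t} | (#|S| == 3) && (union_of X S == y)] L|
     <= #|sunflowers X y 0 L|)%N.
Proof.
pose f (s : L.-tuple {set 'I_t}) := (@finset.set0 'I_t, s).
rewrite -(@card_imset _ _ f) => [|s s' []] //.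
apply: subset_leq_card; apply/subsetP => _ /imsetP[s + ->].
rewrite !inE /= cards0 eqxx /= => /andP[/allP sH ->]; rewrite andbT.
have sP P : P \in tval s -> (#|P| == 3) && (union_of X P == y).
  move=> /sH PH; have : P \in [set S : {set 'I_t} | (#|S| == 3) && (union_of X S == y)] := PH.
  by rewrite inE.
apply/and3P; split; apply/allP => P /sP /andP[P3 Py] //; last by rewrite set0U.
by rewrite /disj -setI_eq0 set0I.
Qed.

(** The mean number of pairs of an outcome [y] and an [L]-matching of [H] whose edges all have
    outcome [y] is below 1, so some code leaves no such matching. *)
Lemma exists_separating_code (R : realFieldType) m w H L (q : R) : (w <= m)%N ->
  {in H, forall S, #|S| = 3} -> 0 <= q ->
  (forall (P : {set 'I_t}) y, #|P| = 3 ->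
     expect (fun X : {ffun 'I_t -> word m w} => (union_of X P == y)%:R) <= q) ->
  2 ^+ m * (#|matchings H L|%:R * q ^+ L) < 1 ->
  exists X : {ffun 'I_t -> word m w}, forall y (M : seq {set 'I_t}),
    size M = L -> {subset M <= [set S in H | union_of X S == y]} ->
    ~~ pairwise (@disj _) M.
Proof.
move=> wm H3 q0 le_q small.
pose f (X : {ffun 'I_t -> word m w}) : R := \sum_(y : {set 'I_m})
  \sum_(s in matchings H L) (all (fun P => union_of X P == y) s)%:R.
have [X leX] := expect_witness wm f; exists X => y M sM MH; apply/negP => dM.
have : f X < 1.
  apply: le_lt_trans leX (le_lt_trans _ small); rewrite /f expect_sum.
  have -> : 2 ^+ m = #|{: {set 'I_m}}|%:R :> R.
    by rewrite -natrX -cardsT -powersetT card_powerset cardsT card_ord.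
  rewrite mulr_natl -[#|{: _}|]/(#|_|) -sumr_const; apply: ler_sum => z _.
  rewrite expect_sum mulr_natl -sumr_const; apply: ler_sum => s.
  rewrite inE => /andP[/allP sH ds].
  rewrite (eq_expect (g := fun X => (all (fun P => finset.set0 :|: union_of X P == z) s)%:R)).
    rewrite -[X in q ^+ X](size_tuple s); apply: expect_petals => // P Ps.
    rewrite (eq_expect (g := fun X => (union_of X P == z)%:R)) ?le_q //.
      by apply: H3; apply: sH.
    by move=> X'; rewrite set0U.
  by move=> X'; congr (nat_of_bool _)%:R; apply: eq_all => P; rewrite set0U.
rewrite ltNge => /negP; apply.
have sMH : tcast sM (in_tuple M) \in matchings H L.
  rewrite inE val_tcast /= dM andbT; apply/allP => P /MH.
  by rewrite inE => /andP[].
rewrite /f (bigD1 y) //= (bigD1 _ sMH) /= -addrA.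
have -> : all (fun P => union_of X P == y) (tcast sM (in_tuple M)).
  by rewrite val_tcast /=; apply/allP => P /MH; rewrite inE => /andP[].
rewrite lerDl addr_ge0 //.
  by apply: sumr_ge0 => s _; rewrite ler0n.
by apply: sumr_ge0 => z _; apply: sumr_ge0 => s _; rewrite ler0n.
Qed.
End CodeStages.

(** * Numerical estimates *)

Section Numerics.
Variables (R : realFieldType) (r : R).
Hypotheses (r_gt0 : 0 < r) (r3 : r ^+ 3 = 2).
Let lam := r - 1.

Lemma r_bounds : 5 / 4 < r < 63 / 50.
Proof.
have r0 := ltW r_gt0; apply/andP; split; rewrite ltNge; apply/negP => le_r.
  have : r ^+ 3 <= (5 / 4) ^+ 3 by rewrite lerXn2r ?nnegrE ?divr_ge0.
  by rewrite r3; lra.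
have : (63 / 50) ^+ 3 <= r ^+ 3 by rewrite lerXn2r ?nnegrE ?divr_ge0.
by rewrite r3; lra.
Qed.

Lemma lam_bounds : 1 / 4 < lam < 13 / 50.
Proof. by have := r_bounds; rewrite /lam; lra. Qed.

Lemma lam_gt0 : 0 < lam.
Proof. by have := lam_bounds; lra. Qed.

(* [lam / (1 + lam)] is the density of ones that makes a union of three random
   words contain a given position with probability exactly 1/2. *)
Definition mode m : 'I_m.+1 :=
  [arg max_(k > (ord0 : 'I_m.+1)) ('C(m, k)%:R * lam ^+ k)]%O.

(** The largest term of the expansion of [r ^+ m = (1 + lam) ^+ m], hence equal to it up to a factor
    [m.+1]. Its inverse cube, which bounds the probability that three words have a given union, is
    [2 ^- m] up to a polynomial factor. *)
Definition mass m : R := 'C(m, mode m)%:R * lam ^+ mode m.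

Lemma mode_max m k : (k <= m)%N -> 'C(m, k)%:R * lam ^+ k <= mass m.
Proof.
rewrite -ltnS /mass /mode => km.
case: Order.TotalTheory.arg_maxP => // w _ max_w.
exact: (max_w (Ordinal km)).
Qed.

Lemma mode_le m : (mode m <= m)%N.
Proof. by rewrite -ltnS. Qed.

Lemma mass_gt0 m : 0 < mass m.
Proof. by rewrite mulr_gt0 ?exprn_gt0 ?lam_gt0 // ltr0n bin_gt0 mode_le. Qed.

Lemma mass_ge m : r ^+ m <= m.+1%:R * mass m.
Proof.
have -> : r ^+ m = \sum_(k < m.+1) 'C(m, k)%:R * lam ^+ k.
  rewrite -[r](subrK 1) addrC exprDn; apply: eq_bigr => k _.
  by rewrite expr1n mul1r mulr_natl.
apply: (@le_trans _ _ (\sum_(k < m.+1) mass m)).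
  by apply: ler_sum => k _; apply: mode_max; rewrite -ltnS.
by rewrite sumr_const card_ord mulr_natl.
Qed.

(** With [w] the mode, the next term is [(m - w) * lam / (w + 1)] times the modal one; this ratio is
    at most 1, and [lam > 1/4]. *)
Lemma mode_lb m : (m <= 5 * mode m + 4)%N.
Proof.
have [wm|wm] := ltnP (mode m) m; last by apply: leq_trans wm _; lia.
have := mode_max wm; rewrite /mass exprS mulrCA mulrA => h.
have W0 : 0 < 'C(m, mode m)%:R :> R by rewrite ltr0n bin_gt0 mode_le.
have l0 := lam_bounds.
move: h; rewrite ler_pM2r ?exprn_gt0 ?lam_gt0 // => h.
have /(congr1 (fun n => n%:R : R)) := mul_bin_left m (mode m).
rewrite !natrM (natrB _ (ltnW wm)) => E.
suff : (m%:R : R) <= (5 * mode m + 4)%:R by rewrite ler_nat.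
rewrite natrD natrM.
have S1 : ((mode m).+1%:R : R) = (mode m)%:R + 1 by rewrite -natr1.
rewrite S1 in E.
have w0 : 0 <= (mode m)%:R :> R by rewrite ler0n.
have wm' : (mode m)%:R <= m%:R :> R by rewrite ler_nat ltnW.
have : (m%:R - (mode m)%:R) * lam <= (mode m)%:R + 1 :> R.
  rewrite -(ler_pM2r W0) mulrAC -E -mulrA.
  by apply: ler_wpM2l => //; lra.
nra.
Qed.

(** The same comparison with the preceding term, now with [lam < 13/50]. *)
Lemma mode_ub m : 126 * (mode m)%:R <= 26 * (m%:R + 1) :> R.
Proof.
have m0 : 0 <= m%:R :> R by rewrite ler0n.
case E : (nat_of_ord (mode m)) => [|w]; first by lra.
have wm : (w < m)%N by rewrite -E mode_le.
have := mode_max (ltnW wm); rewrite /mass E exprS mulrA => h.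
have W0 : 0 < 'C(m, w)%:R :> R by rewrite ltr0n bin_gt0 ltnW.
have l0 := lam_bounds.
move: h; rewrite ler_pM2r ?exprn_gt0 ?lam_gt0 // => h.
have /(congr1 (fun n => n%:R : R)) := mul_bin_left m w.
rewrite !natrM (natrB _ (ltnW wm)) => E2.
have w0 : 0 < w.+1%:R :> R by rewrite ltr0n.
have wm' : w%:R <= m%:R :> R by rewrite ler_nat ltnW.
have : w.+1%:R <= (m%:R - w%:R) * lam :> R.
  rewrite -(ler_pM2r W0) mulrAC -E2 -mulrA.
  by apply: ler_wpM2l => //; exact: ltW.
rewrite -natr1 => h2; nra.
Qed.

Lemma expect_petal_mass (V : finType) m (v : R) (P : {set V}) (B y : {set 'I_m}) : 0 < v ->
  expect (fun X : {ffun V -> word m (mode m)} => (B :|: union_of X P == y)%:R)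
    <= tilt v #|P| B y * (lam / v) ^+ (mode m * #|P|) / mass m ^+ #|P|.
Proof.
move=> v0; apply: le_trans (expect_petal (mode_le m) _ _ _ v0) _.
have l0 := lam_gt0; rewrite card_word /mass !exprMn exprVn !exprM.
rewrite le_eqVlt; apply/orP; left; apply/eqP; field.
by rewrite !expf_neq0 ?gt_eqF ?exprn_gt0 // ltr0n bin_gt0 mode_le.
Qed.

(** Equal to [(1 + 2/5) ^+ 3 - 1], the factor that three words tilted by 2/5 give to each position
    of [y]. *)
Definition nu : R := 218 / 125.

(** Here [j] is the size of the core and [b] that of [y]. The tilts are [lam] and [2/5] for [j = 0],
    [2/5] for [j = 1], and [1] and [nu^-1] for [j = 2]. The tilt [nu^-1] makes [nu ^+ b] cancel in
    the product of the cases 0 and 2. *)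
Definition petal_prob m j b : R :=
  let w := nat_of_ord (mode m) in
  match j with
  | 0 => Num.min 1 (nu ^+ b * (5 / 2 * lam) ^+ (w * 3)) / mass m ^+ 3
  | 1 => (49 / 4 * lam ^+ 2) ^+ w / mass m ^+ 2
  | _ => Num.min ((4 * lam) ^+ w) (((1 + nu) ^+ 2 * nu * lam) ^+ w / nu ^+ b) / mass m
  end.

Lemma nu_gt0 : 0 < nu. Proof. by rewrite /nu; lra. Qed.

Lemma petal_prob_gt0 m j b : 0 < petal_prob m j b.
Proof.
have l0 := lam_gt0; have n0 := nu_gt0; have c0 := mass_gt0 m.
have n1 : 0 < 1 + nu by rewrite addr_gt0.
have l1 : 0 < 5 / 2 * lam by lra.
have l2 : 0 < 4 * lam by lra.
have l3 : 0 < 49 / 4 * lam ^+ 2 by rewrite mulr_gt0 ?exprn_gt0 //; lra.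
have l4 : 0 < (1 + nu) ^+ 2 * nu * lam by rewrite mulr_gt0 // mulr_gt0 // exprn_gt0.
by case: j => [|[|j]] /=; rewrite divr_gt0 ?exprn_gt0 ?lt_min ?ltr01 //=
  ?exprn_gt0 ?divr_gt0 ?mulr_gt0 ?exprn_gt0 //.
Qed.

Lemma le_minM (x a b d : R) : x <= a * d -> x <= b * d -> x <= Num.min a b * d.
Proof. by rewrite /Num.min; case: ifP. Qed.

Lemma card_union_of (V : finType) m w (X : {ffun V -> word m w}) (K : {set V}) :
  (#|union_of X K| <= #|K| * w)%N.
Proof.
rewrite /union_of -[#|K|]sum1_card big_distrl /=.
elim/big_rec2: _ => [|v n A _ le_A]; first by rewrite cards0.
by rewrite mul1n (leq_trans (leq_card_setU _ _)) // leq_add // (eqP (valP (X v))).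
Qed.

Lemma expect_petal_prob (V : finType) m (X0 : {ffun V -> word m (mode m)})
    (K P : {set V}) y :
  (#|K| < 3)%N -> #|P| = (3 - #|K|)%N ->
  expect (fun X : {ffun V -> word m (mode m)} => (union_of X0 K :|: union_of X P == y)%:R)
    <= petal_prob m #|K| #|y|.
Proof.
move=> K3 cP; set B := union_of X0 K; set w := nat_of_ord (mode m).
have l0 := lam_gt0; have n0 := nu_gt0; have c0 := mass_gt0 m.
have le_tilt v := @expect_petal_mass V m v P B y.
have [By|nBy] := boolP (B \subset y); last first.
  apply: le_trans (le_tilt 1 ltr01) _.
  by rewrite /tilt (negPf nBy) mul0r mul0r ltW // petal_prob_gt0.
have Bw : (#|B| <= #|K| * w)%N by apply: card_union_of.
have yB : (#|y :\: B| = #|y| - #|B|)%N by rewrite cardsD (setIidPr By).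
have By' := subset_leq_card By.
move: le_tilt; rewrite /tilt By yB cP.
case K1 : #|K| K3 Bw cP => [|[|[|//]]] _ Bw cP le_tilt.
- have {}Bw : #|B| = 0%N by lia.
  move: le_tilt; rewrite Bw !subn0 => le_tilt.
  have v0 : 0 < 2 / 5 :> R by lra.
  apply: le_minM; [apply: le_trans (le_tilt _ l0) _ | apply: le_trans (le_tilt _ v0) _].
  + by rewrite /lam addrC subrK r3 expr0 divff ?gt_eqF // expr1n !mul1r mulr1 addrK expr1n mul1r.
  + have -> : lam / (2 / 5) = 5 / 2 * lam by field.
    have -> : (1 + 2 / 5) ^+ 3 - 1 = nu by rewrite /nu; field.
    by rewrite expr0 mul1r.
- have {}Bw : #|B| = w.
    have /cards1P[a Ka] : #|K| == 1%N by rewrite K1.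
    by rewrite /B Ka /union_of big_set1 (eqP (valP (X0 a))).
  have v0 : 0 < 2 / 5 :> R by lra.
  apply: le_trans (le_tilt _ v0) _; rewrite ler_pM2r ?invr_gt0 ?exprn_gt0 //.
  rewrite Bw -exprM.
  have -> : lam / (2 / 5) = 5 / 2 * lam by field.
  (* Positions of [y] outside [B] have the factor [(1 + 2/5) ^+ 2 - 1 = 24/25], which is bounded by
     1. *)
  apply: (@le_trans _ _ ((1 + 2 / 5) ^+ (2 * w) * (5 / 2 * lam) ^+ (w * 2))).
    have l1 : 0 < 5 / 2 * lam by lra.
    rewrite ler_pM2r ?exprn_gt0 //; apply: ler_piMr; first by rewrite exprn_ge0 //; lra.
    by apply: exprn_ile1; lra.
  rewrite [(w * 2)%N]mulnC !exprM -exprMn le_eqVlt; apply/orP; left; apply/eqP.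
  by congr (_ ^+ _); field.
- have cast_c : mass m ^+ (3 - 2) = mass m by rewrite expr1.
  move: le_tilt; rewrite muln1 => le_tilt.
  have v0 : 0 < nu^-1 by rewrite invr_gt0.
  (* Each tilt leaves a base at least 1 with exponent [#|B|], which is at most [2 * w]. *)
  apply: le_minM; [apply: le_trans (le_tilt _ ltr01) _ | apply: le_trans (le_tilt _ v0) _].
  + rewrite !expr1 addrK expr1n mulr1 divr1 ler_pM2r ?invr_gt0 // exprMn.
    rewrite ler_pM2r ?exprn_gt0 // -[4]/(2 * 2)%:R natrM -expr2 -exprM.
    by apply: ler_weXn2l => //; lra.
  + rewrite !expr1 ler_pM2r ?invr_gt0 // invrK addrAC subrr add0r.
    have -> : (1 + nu^-1) ^+ #|B| * nu^-1 ^+ (#|y| - #|B|) * (lam * nu) ^+ w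
       = (1 + nu) ^+ #|B| * ((nu * lam) ^+ w / nu ^+ #|y|).
      rewrite -{2}(subnK By') exprD exprVn -[1 + nu^-1](_ : (1 + nu) / nu = _).
        rewrite exprMn exprVn [lam * nu]mulrC; field.
        by rewrite !expf_neq0 // gt_eqF.
      by field; rewrite gt_eqF.
    rewrite mulrA ler_pM2r ?invr_gt0 ?exprn_gt0 // -mulrA [leRHS]exprMn.
    have nl : 0 < nu * lam by rewrite mulr_gt0.
    rewrite ler_pM2r ?exprn_gt0 // -exprM.
    by apply: ler_weXn2l => //; lra.
Qed.

Lemma le_pow_mode (x y : R) k w : 0 <= x <= 1 -> (5 * k <= w)%N -> x ^+ 5 <= y ->
  x ^+ w <= y ^+ k.
Proof.
move=> /andP[x0 x1] kw xy; apply: (@le_trans _ _ (x ^+ (5 * k))); first exact: ler_wiXn2l.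
by rewrite exprM; apply: lerXn2r; rewrite ?nnegrE ?exprn_ge0 // (le_trans _ xy) ?exprn_ge0.
Qed.

Lemma r2_bounds : 25 / 16 <= r ^+ 2 <= 8 / 5.
Proof.
have /andP[r1 r2] := r_bounds; rewrite expr2.
by apply/andP; split; nra.
Qed.

(** [8281/10000] is [49/4 * (13/50) ^ 2], an upper bound for the base in the case [j = 1]. *)
Lemma pair_numbers :
  (0 <= (8281 / 10000 : R) <= 1) /\ (8281 / 10000) ^+ 5 <= 39 / 100 :> R.
Proof. by split; lra. Qed.

Lemma pair_numbers2 :
  0 <= 39 / 100 * r ^+ 2 * (6 / 5) /\ 39 / 100 * r ^+ 2 * (6 / 5) <= 3 / 4.
Proof. by have := r2_bounds; split; lra. Qed.

(** [26/25] is [4 * (13/50)], an upper bound for [4 * lam]. *)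
Lemma single_numbers : 0 <= (26 / 25 : R) /\ (26 / 25) ^+ 6 <= r ^+ 2.
Proof. by have := r2_bounds; split; lra. Qed.

Lemma mixed_numbers :
  (0 <= (94 / 100 : R) <= 1) /\ (94 / 100) ^+ 5 <= 3 / 4 :> R.
Proof. by split; lra. Qed.

(** * Estimates for codes of length [2.9 log2 T], in powers of [rho] *)

Section Estimates.
Variables (k b : nat).
Hypothesis k13 : (13 <= k)%N.
Let m := (29 * k)%N.
Let T : R := (2 ^ (10 * k))%:R.
Let A : R := m.+1%:R.
Let w := nat_of_ord (mode m).
Definition rho : R := r ^+ k.

Lemma mode_range : (5 * k <= w <= 6 * k)%N.
Proof.
have := mode_lb m; have := mode_ub m; rewrite -/w.
have -> : 126 * w%:R = (126 * w)%:R :> R by rewrite natrM.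
have -> : 26 * (m%:R + 1) = (26 * m.+1)%:R :> R by rewrite natrM natr1.
by rewrite ler_nat /m; lia.
Qed.

Lemma rho_gt0 : 0 < rho. Proof. exact: exprn_gt0. Qed.

Lemma rho3 : rho ^+ 3 = 2 ^+ k.
Proof. by rewrite /rho -exprM mulnC exprM r3. Qed.

Lemma T_rho : T = rho ^+ 30.
Proof. by rewrite /T natrX -r3 /rho -!exprM; congr (_ ^+ _); lia. Qed.

Lemma A_ge1 : 1 <= A. Proof. by rewrite /A ler1n. Qed.

Lemma mass_inv : (mass m)^-1 <= A / rho ^+ 29.
Proof.
have c0 := mass_gt0 m; have p0 := exprn_gt0 29 rho_gt0.
rewrite ler_pdivlMr // mulrC ler_pdivrMr //.
by apply: le_trans (mass_ge m); rewrite /rho -exprM mulnC.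
Qed.

Lemma mass_invX s : (mass m)^-1 ^+ s <= (A / rho ^+ 29) ^+ s.
Proof.
have c0 := mass_gt0 m; have p0 := exprn_gt0 29 rho_gt0; have A1 := A_ge1.
apply: lerXn2r mass_inv; rewrite nnegrE; first by rewrite ltW // invr_gt0.
by rewrite divr_ge0 ?ltW // (lt_le_trans ltr01).
Qed.

(** [T ^+ 2] is [rho ^+ 60] and the masses give back [rho ^+ 58]; the power of [39/100] absorbs the
    remaining [rho ^+ 2] and the polynomial factor. *)
Lemma pair_estimate : A ^+ 4 <= (6 / 5) ^+ k ->
  T ^+ 2 * petal_prob m 1 b <= (3 / 4) ^+ k.
Proof.
move=> A4; have l := lam_bounds; have p0 := rho_gt0; have A1 := A_ge1.
have /andP[w5 _] := mode_range; have rb := r_bounds.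
have A2 : A ^+ 2 <= (6 / 5) ^+ k by apply: le_trans A4; apply: ler_weXn2l.
have X0 : 0 <= 49 / 4 * lam ^+ 2 <= 8281 / 10000.
  by apply/andP; split; nra.
have Xw : (49 / 4 * lam ^+ 2) ^+ w <= (39 / 100) ^+ k.
  apply: (@le_trans _ _ ((8281 / 10000) ^+ w)).
    case/andP: X0 => X0 X1; apply: lerXn2r; rewrite ?nnegrE //; exact: divr_ge0.
  by have [h1 h2] := pair_numbers; apply: le_pow_mode.
rewrite /= -/w T_rho -exprVn.
apply: (@le_trans _ _ (rho ^+ 30 ^+ 2 * ((39 / 100) ^+ k * (A / rho ^+ 29) ^+ 2))).
  apply: ler_wpM2l; [by do ?[exact: ltW | apply: exprn_ge0] | ]; apply: ler_pM => //.
  - by apply: exprn_ge0; case/andP: X0.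
  - by rewrite exprn_ge0 // invr_ge0 ltW // mass_gt0.
  - exact: mass_invX.
have -> : rho ^+ 30 ^+ 2 * ((39 / 100) ^+ k * (A / rho ^+ 29) ^+ 2)
          = (39 / 100) ^+ k * rho ^+ 2 * A ^+ 2.
  by field; rewrite gt_eqF.
apply: (@le_trans _ _ ((39 / 100) ^+ k * rho ^+ 2 * (6 / 5) ^+ k)).
  by apply: ler_wpM2l => //; apply: mulr_ge0; rewrite exprn_ge0 ?divr_ge0 // ltW.
rewrite /rho -exprM [(k * 2)%N]mulnC exprM -!exprMn.
have [h1 h2] := pair_numbers2.
by apply: lerXn2r; rewrite ?nnegrE ?divr_ge0.
Qed.

(** The tilt [lam] suffices: [rho ^+ 90 / rho ^+ 87 = rho ^+ 3 = 2 ^+ k]. *)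
Lemma triple_estimate : T ^+ 3 * petal_prob m 0 b <= 2 ^+ k * A ^+ 4.
Proof.
have p0 := rho_gt0; have A1 := A_ge1; have c0 := mass_gt0 m.
rewrite /= T_rho -exprVn.
apply: (@le_trans _ _ (rho ^+ 30 ^+ 3 * (A / rho ^+ 29) ^+ 3)).
  apply: ler_wpM2l; [by do ?[exact: ltW | apply: exprn_ge0] | ]; apply: le_trans (mass_invX 3).
  by apply: ler_piMl; [rewrite exprn_ge0 // invr_ge0 ltW | rewrite ge_min lexx].
have -> : rho ^+ 30 ^+ 3 * (A / rho ^+ 29) ^+ 3 = rho ^+ 3 * A ^+ 3.
  by field; rewrite gt_eqF.
rewrite rho3 ler_wpM2l ?exprn_ge0 //; exact: ler_weXn2l.
Qed.

(** The tilt 1 suffices: [4 * lam] exceeds 1 so little that, as [w <= 6 * k], its power stays below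
    [rho ^+ 2]. *)
Lemma single_estimate : T * petal_prob m 2 b <= 2 ^+ k * A ^+ 4.
Proof.
have p0 := rho_gt0; have A1 := A_ge1; have c0 := mass_gt0 m.
have l := lam_bounds; have rb := r_bounds; have /andP[_ w6] := mode_range.
have X : (4 * lam) ^+ w <= rho ^+ 2.
  apply: (@le_trans _ _ ((26 / 25) ^+ (6 * k))).
    apply: (@le_trans _ _ ((26 / 25) ^+ w)); last by apply: ler_weXn2l => //; lra.
    by apply: lerXn2r; rewrite ?nnegrE; lra.
  rewrite /rho -exprM mulnC exprM [(k * 2)%N]mulnC exprM.
  have -> : (26 / 25) ^+ k ^+ 6 = ((26 / 25) ^+ 6) ^+ k :> R by rewrite -!exprM mulnC.
  have [h1 h2] := single_numbers.
  by apply: lerXn2r => //; rewrite nnegrE; apply: exprn_ge0 => //; exact: ltW.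
rewrite /= -/w T_rho.
apply: (@le_trans _ _ (rho ^+ 30 * (rho ^+ 2 * (A / rho ^+ 29)))).
  apply: ler_wpM2l; [by do ?[exact: ltW | apply: exprn_ge0] | ]; apply: ler_pM.
  - rewrite le_min exprn_ge0 ?divr_ge0 ?exprn_ge0 ?(ltW nu_gt0) //=; last by lra.
    have n0 := nu_gt0; apply: mulr_ge0; last lra.
    by rewrite mulr_ge0 ?exprn_ge0 ?addr_ge0 // ltW.
  - by rewrite invr_ge0 ltW.
  - by rewrite ge_min X.
  - exact: mass_inv.
have -> : rho ^+ 30 * (rho ^+ 2 * (A / rho ^+ 29)) = rho ^+ 3 * A.
  by field; rewrite gt_eqF.
rewrite rho3 ler_wpM2l ?exprn_ge0 //; exact: (@ler_weXn2l _ A A_ge1 1 4).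
Qed.

(** The second entries of both minima make [nu ^+ b] cancel, so the bound is uniform in [b]. Powers
    of [T] and masses leave [rho ^+ 4], one [rho] too many, which [Y ^+ w] absorbs because
    [Y <= 94/100]. *)
Lemma mixed_estimate :
  (T ^+ 3 * petal_prob m 0 b) * (T * petal_prob m 2 b) <= 2 ^+ k * A ^+ 4.
Proof.
have p0 := rho_gt0; have A1 := A_ge1; have c0 := mass_gt0 m.
have l := lam_bounds; have rb := r_bounds; have /andP[w5 _] := mode_range.
have n0 := nu_gt0; have nb := exprn_gt0 b n0; have l0 := lam_gt0.
pose Y := (5 / 2 * lam) ^+ 3 * ((1 + nu) ^+ 2 * nu * lam).
have Y1 : 0 <= Y <= 94 / 100.
  have -> : Y = 125 / 8 * ((343 / 125) ^+ 2 * (218 / 125)) * lam ^+ 4.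
    by rewrite /Y /nu; field.
  have l4 : lam ^+ 4 <= (13 / 50) ^+ 4 by apply: lerXn2r; rewrite ?nnegrE; lra.
  have l5 : 0 <= lam ^+ 4 by rewrite exprn_ge0 // ltW.
  by apply/andP; split; lra.
have Yw : Y ^+ w <= (3 / 4) ^+ k.
  apply: (@le_trans _ _ ((94 / 100) ^+ w)).
    by case/andP: Y1 => Y0 Y1; apply: lerXn2r; rewrite ?nnegrE //; lra.
  by have [h1 h2] := mixed_numbers; apply: le_pow_mode.
have -> : (T ^+ 3 * petal_prob m 0 b) * (T * petal_prob m 2 b) =
    rho ^+ 120 * ((Num.min 1 (nu ^+ b * (5 / 2 * lam) ^+ (w * 3)) *
      Num.min ((4 * lam) ^+ w) (((1 + nu) ^+ 2 * nu * lam) ^+ w / nu ^+ b)) *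
      (mass m)^-1 ^+ 4).
  by rewrite /= -/w T_rho; field; rewrite gt_eqF.
apply: (@le_trans _ _ (rho ^+ 120 * ((3 / 4) ^+ k * (A / rho ^+ 29) ^+ 4))).
  have min_ge0 (x y : R) : 0 <= x -> 0 <= y -> 0 <= Num.min x y.
    by rewrite le_min => -> ->.
  have h1 : 0 <= nu ^+ b * (5 / 2 * lam) ^+ (w * 3).
    by rewrite mulr_ge0 ?exprn_ge0 //; lra.
  have h2 : 0 <= ((1 + nu) ^+ 2 * nu * lam) ^+ w / nu ^+ b.
    rewrite mulr_ge0 ?invr_ge0 ?exprn_ge0 //; [|lra].
    apply: mulr_ge0; last exact: ltW.
    by apply: mulr_ge0; [apply: exprn_even_ge0 | exact: ltW].
  have h3 : 0 <= (4 * lam) ^+ w by rewrite exprn_ge0 //; lra.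
  apply: ler_wpM2l; [by do ?[exact: ltW | apply: exprn_ge0] | ]; apply: ler_pM.
  - by rewrite mulr_ge0 ?min_ge0.
  - by rewrite exprn_ge0 // invr_ge0 ltW.
  - apply: (@le_trans _ _ ((nu ^+ b * (5 / 2 * lam) ^+ (w * 3)) *
             (((1 + nu) ^+ 2 * nu * lam) ^+ w / nu ^+ b))).
      by apply: ler_pM; rewrite ?min_ge0 // ge_min lexx ?orbT.
    rewrite [(w * 3)%N]mulnC exprM; apply: le_trans Yw.
    rewrite /Y [leRHS]exprMn mulrCA [nu ^+ b * _]mulrC mulfK ?gt_eqF //.
    by rewrite mulrC.
  - exact: mass_invX.
have -> : rho ^+ 120 * ((3 / 4) ^+ k * (A / rho ^+ 29) ^+ 4)
          = rho ^+ 3 * ((rho * (3 / 4) ^+ k) * A ^+ 4).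
  by field; rewrite gt_eqF.
rewrite rho3 ler_wpM2l ?exprn_ge0 //; apply: ler_piMl.
  by rewrite exprn_ge0 // (le_trans ler01).
by rewrite /rho -exprMn; apply: exprn_ile1; lra.
Qed.
End Estimates.
End Numerics.

Lemma leq_sub_ffact n L : ((n - L) ^ L <= n ^_ L)%N.
Proof.
rewrite ffact_prod -[X in (_ ^ X)%N](card_ord L) -prod_nat_const.
by apply: leq_prod => i _; rewrite leq_sub2l // ltnW.
Qed.

Lemma budget_nat1 d g e :
  (4 <= d -> e <= 2 * g + (d * g + g) -> e <= 2 * (d * g))%N.
Proof. by nia. Qed.

Lemma budget_nat2 d g k e q :
  (4 <= d -> 5 * (105 * d) <= g -> e + q <= 3 + 3 * g + (k + g) ->
   e + (105 * d * 3 + (105 * d * 2 + q)) <= k + 6 * g)%N.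
Proof. by lia. Qed.

Lemma budget_nat3 d g e :
  (4 <= d -> 13 <= d * g -> e <= 2 * (d * g) ->
   e + (2 + 29 * (d * g)) < g * (105 * d))%N.
Proof. by nia. Qed.

Lemma budget_nat4 d g :
  (4 <= d -> 13 <= d * g -> 2 + 29 * (d * g) + 20 * (d * g) <= g * (105 * d))%N.
Proof. by nia. Qed.

(** * The strategy with five stages *)

Section Upper.
Variables (R : realFieldType) (r : R).
Hypotheses (r_gt0 : 0 < r) (r3 : r ^+ 3 = 2).

Lemma ceil_log2 (x : R) n : 1 <= x -> x <= 2 ^+ n ->
  exists e, [/\ (e <= n)%N, x <= 2 ^+ e & 2 ^+ e <= 2 * x].
Proof.
move=> x1 xn; have ex : exists e, x <= 2 ^+ e by exists n.
case: (ex_minnP ex) => -[|e] xe min_e.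
  by exists 0%N; split=> //; rewrite expr0; lra.
exists e.+1; split=> //; first exact: min_e.
rewrite exprS ler_pM2l // leNgt; apply/negP => /ltW /min_e.
by rewrite ltnn.
Qed.

Variables (d g t : nat).
(** [10 * k] bounds the logarithm of [t], [d] sets the accuracy, and [g], the share [1/d] of [k], is
    the slack that absorbs polynomial factors. [L] depends on [d] alone, so it stays bounded as [g]
    grows. *)
Let k := (d * g)%N.
Let m := (29 * k)%N.
Let L := (105 * d)%N.
Hypotheses (d4 : (4 <= d)%N) (poly : (m.+1 ^ 4 <= 2 ^ g)%N)
  (g_large : (5 * L <= g)%N) (t_small : (t <= 2 ^ (10 * k))%N).

Let T : R := (2 ^ (10 * k))%:R.
Let M0 b := Num.max 1 (T ^+ 3 * petal_prob r m 0 b).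
Let M2 b := Num.max 1 (T * petal_prob r m 2 b).

Lemma k13 : (13 <= k)%N.
Proof. by move: g_large; rewrite /k /L; nia. Qed.

Lemma poly_real : m.+1%:R ^+ 4 <= 2 ^+ g :> R.
Proof. by rewrite -!natrX ler_nat. Qed.

Lemma M0_ge1 b : 1 <= M0 b. Proof. by rewrite le_max lexx. Qed.
Lemma M2_ge1 b : 1 <= M2 b. Proof. by rewrite le_max lexx. Qed.

(** The product of the maxima is 1 or one of the three quantities already estimated. *)
Lemma M02_le b : M0 b * M2 b <= 2 ^+ (k + g).
Proof.
have A1 : 1 <= m.+1%:R :> R by rewrite ler1n.
have le_kg : 2 ^+ k * m.+1%:R ^+ 4 <= 2 ^+ (k + g) :> R.
  by rewrite exprD ler_wpM2l ?exprn_ge0 // poly_real.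
have h0 := le_trans (triple_estimate r_gt0 r3 b k13) le_kg.
have h2 := le_trans (single_estimate r_gt0 r3 b k13) le_kg.
have h02 := le_trans (mixed_estimate r_gt0 r3 b k13) le_kg.
have h1 : 1 <= 2 ^+ (k + g) :> R by apply: exprn_ege1; rewrite ler1n.
rewrite /M0 /M2 /Num.max; do 2 case: ifP => _; rewrite ?mul1r ?mulr1 //.
Qed.

Lemma M0_le b : M0 b <= 2 ^+ (k + g).
Proof.
apply: le_trans (M02_le b); apply: ler_peMr; last exact: M2_ge1.
exact: le_trans ler01 (M0_ge1 b).
Qed.

Lemma M2_le b : M2 b <= 2 ^+ (k + g).
Proof.
apply: le_trans (M02_le b); apply: ler_peMl; last exact: M0_ge1.
exact: le_trans ler01 (M2_ge1 b).
Qed.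

(** Origin of [105 = 5 * 21] in [L]: as [(3/4) ^ 5 <= 1/4], the power of [3/4] is at most
    [4 ^- (21 * k)]. *)
Lemma pow2_lt_pow34 n : (n < 42 * k)%N -> 2 ^+ n * ((3 / 4) ^+ k) ^+ L < 1 :> R.
Proof.
move=> nk; have k0 := k13.
have h : (3 / 4) ^+ k ^+ L <= (2 ^+ (42 * k))^-1 :> R.
  rewrite -exprM (_ : (k * L = 5 * (21 * d) * k)%N); last by rewrite /L; nia.
  rewrite exprM [(3 / 4) ^+ (5 * _)]exprM [2 ^+ _]exprM -[leRHS]exprVn.
  apply: lerXn2r; rewrite ?nnegrE ?exprn_ge0 ?divr_ge0 ?invr_ge0 ?exprn_ge0 //.
  apply: (@le_trans _ _ ((4^-1) ^+ (21 * d))).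
    by apply: lerXn2r; rewrite ?nnegrE ?exprn_ge0 ?divr_ge0 ?invr_ge0 //; lra.
  apply: (@le_trans _ _ ((4^-1) ^+ 21)).
    by apply: ler_wiXn2l; [rewrite invr_ge0 | rewrite invf_le1 ?ler1n | lia].
  rewrite (_ : 4 = 2 ^+ 2 :> R); last by rewrite -natrX.
  by rewrite !exprVn -!exprM.
apply: (@le_lt_trans _ _ (2 ^+ n * (2 ^+ (42 * k))^-1)).
  by rewrite ler_wpM2l ?exprn_ge0.
by rewrite ltr_pdivrMr ?exprn_gt0 // mul1r ltr_eXn2l // ltr1n.
Qed.

Lemma poly_pair : m.+1%:R ^+ 4 <= (6 / 5) ^+ k :> R.
Proof.
apply: le_trans poly_real _; apply: (@le_trans _ _ ((6 / 5) ^+ (4 * g))).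
  by rewrite exprM; apply: lerXn2r; rewrite ?nnegrE ?exprn_ge0 ?divr_ge0 //; lra.
by apply: ler_weXn2l; [lra | rewrite /k leq_mul2r d4 orbT].
Qed.

Lemma good_code : exists X : {ffun 'I_t -> word m (mode r m)}, forall y,
  [/\ #|sunflowers X y 1 L| = 0%N,
      #|sunflowers X y 0 L|%:R <= 3 * 2 ^+ m * M0 #|y| ^+ L &
      #|sunflowers X y 2 L|%:R <= 3 * 2 ^+ m * (T ^+ 2 * M2 #|y| ^+ L)].
Proof.
have T_gt0 : (0 < 2 ^ (10 * k))%N by rewrite expn_gt0.
have T0 : 0 < T by rewrite /T ltr0n.
have [|||X X_ok] := @exists_code R 'I_t m (mode r m) (mode_le r m)
  (fun j y => petal_prob r m j #|y|) L _ T_gt0.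
- by rewrite card_ord.
- by move=> j y; apply: petal_prob_gt0.
- by move=> X0 K P y; apply: expect_petal_prob.
exists X => y; split.
- have := X_ok 1%N y isT; rewrite -/T => le1.
  (* A count below 1 vanishes; the exponent [2 + m + 10 * k] is [2 + 39 * k], below [42 * k]. *)
  have : (#|sunflowers X y 1 L|%:R < 1 :> R).
    apply: le_lt_trans le1 _.
    apply: (@le_lt_trans _ _ (2 ^+ (2 + m + 10 * k) * ((3 / 4) ^+ k) ^+ L)); last first.
      by apply: pow2_lt_pow34; rewrite /m; have := k13; lia.
    rewrite mulrA; apply: ler_pM.
    + by rewrite !mulr_ge0 ?exprn_ge0 // ltW.
    + by rewrite exprn_ge0 // mulr_ge0 ?exprn_ge0 ?ltW // petal_prob_gt0.
    + rewrite expr1 /T natrX [2 ^+ (2 + m + _)]exprD [2 ^+ (2 + m)]exprD.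
      by rewrite ler_pM2r ?exprn_gt0 // ler_pM2r ?exprn_gt0 //; lra.
    + apply: lerXn2r; rewrite ?nnegrE ?exprn_ge0 ?divr_ge0 //.
        by rewrite mulr_ge0 ?exprn_ge0 ?ltW // petal_prob_gt0.
      exact: (pair_estimate r_gt0 r3 #|y| k13 poly_pair).
  by rewrite -[X in _ < X]/(1%:R) ltr_nat ltnS leqn0 => /eqP.
- apply: le_trans (X_ok 0%N y isT) _; rewrite -/T expr0 mul1r.
  rewrite ler_pM2l ?mulr_gt0 ?exprn_gt0 //; apply: lerXn2r; rewrite ?nnegrE.
  + by rewrite mulr_ge0 ?exprn_ge0 ?ltW // petal_prob_gt0.
  + exact: le_trans ler01 (M0_ge1 _).
  + by rewrite le_max lexx orbT.
- apply: le_trans (X_ok 2%N y isT) _; rewrite -/T expr1.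
  rewrite ler_pM2l ?mulr_gt0 ?exprn_gt0 // ler_pM2l ?exprn_gt0 //; apply: lerXn2r; rewrite ?nnegrE.
  + by rewrite mulr_ge0 ?ltW // petal_prob_gt0.
  + exact: le_trans ler01 (M2_ge1 _).
  + by rewrite le_max lexx orbT.
Qed.

(* Stage 2 needs [log2 (M0 b)] tests up to lower order terms, stage 5
   [log2 (M2 b)], and only the product [M0 b * M2 b] is small. *)
Lemma test_budget b : exists e q, [/\
  2 ^+ (2 * g) * M0 b <= 2 ^+ e, L%:R + 2 ^+ g * M2 b <= 2 ^+ q,
  (e <= 2 * k)%N & (e + (L * 3 + (L * 2 + q)) <= k + 6 * g)%N].
Proof.
have p1 n : 1 <= 2 ^+ n :> R by apply: exprn_ege1; rewrite ler1n.
have p0 n : 0 < 2 ^+ n :> R by rewrite exprn_gt0.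
have M01 := M0_ge1 b; have M21 := M2_ge1 b.
have M00 : 0 <= M0 b by apply: le_trans M01.
have M20 : 0 <= M2 b by apply: le_trans M21.
have L0 : 0 <= L%:R :> R by rewrite ler0n.
have Lg : L%:R <= 2 ^+ g * M2 b.
  apply: (@le_trans _ _ (2 ^+ g)); last by apply: ler_peMr => //; apply: ltW.
  rewrite -natrX ler_nat; apply: leq_trans (ltnW (ltn_expl g (ltnSn 1))).
  by apply: leq_trans g_large; rewrite leq_pmull.
have [||e [e_le e1 e2]] := @ceil_log2 (2 ^+ (2 * g) * M0 b) (2 * g + (k + g)).
- exact: mulr_ege1.
- by rewrite exprD ler_pM2l // M0_le.
have [||q [q_le q1 q2]] := @ceil_log2 (L%:R + 2 ^+ g * M2 b) (1 + (g + (k + g))).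
- by apply: ler_wpDl => //; apply: mulr_ege1.
- apply: (@le_trans _ _ (2 * (2 ^+ g * M2 b))); first by lra.
  by rewrite exprD expr1 ler_pM2l // exprD ler_pM2l // M2_le.
exists e, q; split => //.
  by apply: budget_nat1 d4 e_le.
(* The two roundings cost a factor 2 each and the summand [L%:R] a third one, whence [2 ^+ 3]. *)
have : 2 ^+ (e + q) <= 2 ^+ (3 + 3 * g + (k + g)) :> R.
  rewrite exprD; apply: (@le_trans _ _ ((2 * (2 ^+ (2 * g) * M0 b)) * (4 * (2 ^+ g * M2 b)))).
    apply: ler_pM; rewrite ?exprn_ge0 //; apply: le_trans q2 _; lra.
  have -> : 2 * (2 ^+ (2 * g) * M0 b) * (4 * (2 ^+ g * M2 b))
    = 2 ^+ (3 + 3 * g) * (M0 b * M2 b).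
    rewrite [2 ^+ (3 + _)]exprD (_ : 3 * g = 2 * g + g)%N; last by rewrite mulSn addnC.
    by rewrite [2 ^+ (2 * g + g)]exprD; ring.
  by rewrite [leRHS]exprD ler_pM2l // M02_le.
rewrite ler_eXn2l ?ltr1n // => eq_le.
exact: budget_nat2 d4 g_large eq_le.
Qed.

Lemma solvable_stage2 (X : {ffun 'I_t -> word m (mode r m)}) y :
  [/\ #|sunflowers X y 1 L| = 0%N,
      #|sunflowers X y 0 L|%:R <= 3 * 2 ^+ m * M0 #|y| ^+ L &
      #|sunflowers X y 2 L|%:R <= 3 * 2 ^+ m * (T ^+ 2 * M2 #|y| ^+ L)] ->
  solvable 4 [set S : {set 'I_t} | (#|S| == 3) && (union_of X S == y)] (k + 6 * g).
Proof.
set H := [set S | _]; set b := #|y| => -[sun1 sun0 sun2].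
have [e [q [e_ok q_ok ek budget]]] := test_budget b.
have p0 n : 0 < 2 ^+ n :> R by rewrite exprn_gt0.
have M01 := M0_ge1 b; have M21 := M2_ge1 b.
have H3 : {in H, forall S : {set 'I_t}, #|S| = 3} by move=> S; rewrite inE => /andP[/eqP].
have M00 : 0 <= M0 b := le_trans ler01 M01.
have M20 : 0 <= M2 b := le_trans ler01 M21.
have c0 : 0 < mass r e := mass_gt0 r_gt0 r3 e.
have C0 : 0 <= 1 / mass r e ^+ 3 by rewrite divr_ge0 // exprn_ge0 // ltW.
have [|||X2 X2_ok] := @exists_separating_code t R e (mode r e) H L
  (1 / mass r e ^+ 3) (mode_le r e) H3.
- exact: C0.
- move=> P z P3.
  rewrite (eq_expect (g := fun X => (finset.set0 :|: union_of X P == z)%:R)); last first.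
    by move=> X'; rewrite set0U.
  have l0 := lam_gt0 r_gt0 r3.
  apply: le_trans (expect_petal_mass r_gt0 r3 P finset.set0 z l0) _.
  rewrite /tilt sub0set P3 cards0 setD0 expr0 divff ?gt_eqF // expr1n.
  have -> : 1 + (r - 1) = r by rewrite addrC subrK.
  by rewrite r3 addrK expr1n !mul1r.
(* The collision bound is at most [e.+1 ^ 3 / 2 ^ e]; of the reserve [2 ^+ (2 * g)] in the choice of
   [e], half of the exponent pays for the polynomial and half remains as a gain per edge. *)
- have small : M0 b * (1 / mass r e ^+ 3) <= (2 ^+ g)^-1.
    have A1 : 1 <= e.+1%:R :> R by rewrite ler1n.
    have e3 : e.+1%:R ^+ 3 <= 2 ^+ g :> R.
      rewrite -!natrX ler_nat; apply: leq_trans poly.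
      apply: leq_trans (_ : m.+1 ^ 3 <= _)%N; last by apply: leq_pexp2l.
      by rewrite leq_exp2r // ltnS; apply: leq_trans ek _; apply: leq_mul.
    have ce : 2 ^+ e <= e.+1%:R ^+ 3 * mass r e ^+ 3.
      rewrite -exprMn -r3 -exprM mulnC exprM; apply: lerXn2r; last exact: mass_ge.
        by rewrite nnegrE exprn_ge0 // ltW.
      by rewrite nnegrE mulr_ge0 ?ler0n ?ltW.
    rewrite mul1r ler_pdivrMr ?exprn_gt0 // mulrC ler_pdivlMr //.
    rewrite -(ler_pM2l (p0 g)).
    apply: (@le_trans _ _ (2 ^+ (2 * g) * M0 b)).
      rewrite (_ : 2 ^+ g * (M0 b * 2 ^+ g) = 2 ^+ (2 * g) * M0 b) //.
      by rewrite mul2n -addnn [2 ^+ (g + g)]exprD; ring.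
    apply: le_trans e_ok (le_trans ce _).
    by rewrite ler_pM2r ?exprn_gt0.
  have small_L : M0 b ^+ L * (1 / mass r e ^+ 3) ^+ L <= (2 ^+ (g * L))^-1.
    rewrite -exprMn exprM -exprVn; apply: lerXn2r small; rewrite nnegrE.
      exact: mulr_ge0.
    by rewrite invr_ge0 ltW.
  apply: (@le_lt_trans _ _ (2 ^+ e * (2 ^+ (2 + m) * (2 ^+ (g * L))^-1))).
    rewrite ler_pM2l //; apply: (@le_trans _ _ (3 * 2 ^+ m * M0 b ^+ L * (1 / mass r e ^+ 3) ^+ L)).
      apply: ler_wpM2r; first exact: exprn_ge0.
      by apply: le_trans sun0; rewrite ler_nat card_matchings.
    rewrite -mulrA; apply: ler_pM => //.
    + by rewrite mulr_ge0 // ltW.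
    + by apply: mulr_ge0; apply: exprn_ge0.
    + by rewrite exprD ler_pM2r //; lra.
  rewrite mulrA -exprD ltr_pdivrMr // mul1r ltr_eXn2l ?ltr1n //.
  exact: budget_nat3 d4 k13 ek.
apply: solvable_leq budget _; apply: (solvable_code (X := X2)) => z.
apply: solvable_triples.
- by move=> S; rewrite inE => /andP[/H3].
- by move=> M sM MH; apply: X2_ok sM MH.
- move=> a M sM aM MH; apply: (no_link_matching sun1 sM aM) => S SM.
  by have := MH S SM; rewrite inE => /andP[].
move=> a b' ab; pose F := [set S : {set 'I_t} |
  (#|S| == 3) && (union_of X S == y) & (a \in S) && (b' \in S)].
apply: (@leq_trans #|F|).
  by apply: subset_leq_card; apply/subsetP => S; rewrite !inE => /andP[/andP[-> _] ->].
rewrite -(ler_nat R) natrX; apply: le_trans q_ok.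
have gM : 0 <= 2 ^+ g * M2 b by apply: mulr_ge0 => //; apply: ltW.
(* At most [L] completions are paid for by the summand [L%:R]. Otherwise [(#|F| - L) ^ L] is at most
   the number of sunflowers, whose prefactor [3 * 2 ^+ m * T ^+ 2] is dominated by
   [(2 ^+ g) ^+ L]. *)
have [nL|nL] := leqP #|F| L; first by apply: ler_wpDr; rewrite ?ler_nat.
rewrite -lerBlDl -natrB; last exact: ltnW.
rewrite leNgt; apply/negP => big.
have L0 : (0 < L)%N by rewrite muln_gt0 (leq_trans _ d4).
have : (2 ^+ g * M2 b) ^+ L < 3 * 2 ^+ m * (T ^+ 2 * M2 b ^+ L).
  apply: (@lt_le_trans _ _ ((#|F| - L)%:R ^+ L)).
    by rewrite ltrXn2r ?nnegrE ?ler0n // -lt0n.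
  apply: le_trans sun2; rewrite -natrX ler_nat.
  exact: leq_trans (leq_sub_ffact _ _) (card_completions X y L ab).
rewrite exprMn [3 * _ * (_ * _)]mulrA ltr_pM2r ?exprn_gt0 ?(lt_le_trans ltr01 M21) //.
apply/negP; rewrite -leNgt -exprM.
apply: (@le_trans _ _ (2 ^+ (2 + m + 20 * k))).
  rewrite [2 ^+ (2 + m + _)]exprD [2 ^+ (2 + m)]exprD; apply: ler_pM => //.
  - by rewrite mulr_ge0 // ltW.
  - by rewrite exprn_ge0 // ler0n.
  - by rewrite ler_pM2r //; lra.
  - by rewrite /T natrX -exprM le_eqVlt; apply/orP; left; rewrite mulnAC.
apply: ler_weXn2l; first by rewrite ler1n.
exact: budget_nat4 d4 k13.
Qed.

Lemma solvable_upper :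
  solvable 5 [set S : {set 'I_t} | #|S| == 3] (30 * k + 6 * g).
Proof.
have [X X_ok] := good_code.
have -> : (30 * k + 6 * g = m + (k + 6 * g))%N by rewrite /m; lia.
apply: (solvable_code (X := X)) => y; apply: solvable_sub (solvable_stage2 (X_ok y)).
by apply/subsetP => S; rewrite !inE.
Qed.

End Upper.

(** * The limit *)

(** With [h = g %/ 8], [(c * g).+1] is at most [(8 * c).+1 * h.+1], both factors are at most
    [2 ^ h], and [8 * h <= g]. *)
Lemma poly_leq_exp c : exists g0, forall g, (g0 <= g)%N -> ((c * g).+1 ^ 4 <= 2 ^ g)%N.
Proof.
exists (8 * (8 * c).+1)%N => g g0; pose h := (g %/ 8)%N.
have h_large : ((8 * c).+1 <= h)%N by rewrite leq_divRL // mulnC.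
have gh : (g < 8 * h.+1)%N by rewrite mulnC; apply: ltn_ceil.
apply: (@leq_trans ((2 ^ (2 * h)) ^ 4)%N).
  rewrite leq_exp2r // mul2n -addnn expnD.
  apply: (@leq_trans ((8 * c).+1 * h.+1)%N).
    by move: gh h_large; clear; nia.
  apply: leq_mul; last exact: ltn_expl.
  exact: leq_trans h_large (ltnW (ltn_expl _ _)).
rewrite -expnM leq_exp2l // (_ : 2 * h * 4 = h * 8)%N; last by lia.
exact: leq_trunc_div.
Qed.

(** Information bound by induction on the stages: the first stage splits [F] into at most [2 ^ size
    (A [::])] classes, each decoded by the rest of the algorithm. *)
Lemma card_decodable t p (A : algo t) dec (F : {set {set 'I_t}}) n :
  {in F, forall S, dec (hist A S p) = S /\ (ntests A S p <= n)%N} -> (#|F| <= 2 ^ n)%N.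
Proof.
elim: p A dec F n => [|p IHp] A dec F n dec_ok.
  apply: (@leq_trans 1%N); last by rewrite expn_gt0.
  apply/card_le1_eqP => S S' /dec_ok[<- _] /dec_ok[<- _]; by [].
have [->|[S0 /dec_ok[_]]] := set_0Vmem F; first by rewrite cards0.
rewrite ntests_shift => /(leq_trans (leq_addr _ _)) An.
pose m := size (A [::]); pose out S : m.-tuple bool := map_tuple (outcome S) (in_tuple (A [::])).
rewrite -sum1_card (partition_big out xpredT) //= -(subnKC An) expnD.
rewrite -[X in (2 ^ X * _)%N]/m -[X in (X ^ _ * _)%N]card_bool -card_tuple -sum_nat_const.
apply: leq_sum => o _.
rewrite (eq_bigl (mem [set S in F | out S == o])) => [|S]; last by rewrite !inE.
rewrite sum1_card; apply: (IHp (fun h => A (tval o :: h)) (fun h => dec (tval o :: h))) => S.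
rewrite inE => /andP[/dec_ok[decS nS] /eqP outS].
have oS : outcomes (A [::]) S = tval o by rewrite -outS.
move: decS nS; rewrite hist_shift ntests_shift oS => -> nS; split=> //.
by rewrite leq_subRL.
Qed.

Lemma feasible_lower p t s n : feasible p t s n -> ('C(t, s) <= 2 ^ n)%N.
Proof.
case=> A [[dec dec_ok] nt_ok].
have -> : 'C(t, s) = #|[set S : {set 'I_t} | #|S| == s]|.
  rewrite -[X in 'C(X, _)]card_ord -cardsT -cards_draws; apply: eq_card => S.
  by rewrite !inE subsetT.
apply: (@card_decodable t p A dec) => S; rewrite inE => /eqP Ss.
by split; [apply: dec_ok | apply: nt_ok].
Qed.

From mathcomp Require Import all_classical all_reals all_analysis.

Lemma Ntests_ub p t s n : feasible p t s n -> (Ntests p t s <= n)%N.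
Proof.
move=> fn; rewrite /Ntests; case: pselect => [h|//].
by case: ex_minnP => m _; apply; apply/asboolP.
Qed.

Lemma Ntests_feasible p t s : (exists n, feasible p t s n) -> feasible p t s (Ntests p t s).
Proof.
by move=> ex; rewrite /Ntests; case: pselect => // h; case: ex_minnP => m /asboolP.
Qed.

Lemma cube_root2 (R : realType) : exists2 r : R, 0 < r & r ^+ 3 = 2.
Proof.
exists (2 `^ 3^-1); first exact: powR_gt0.
by rewrite -powR_mulrn ?powR_ge0 // -powRrM mulVf // powRr1.
Qed.

Lemma feasible5 (R : realType) d g t : (4 <= d)%N ->
  ((29 * (d * g)).+1 ^ 4 <= 2 ^ g)%N -> (5 * (105 * d) <= g)%N ->
  (t <= 2 ^ (10 * (d * g)))%N -> feasible 5 t 3 (30 * (d * g) + 6 * g).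
Proof.
move=> d4 poly g_large t_small; have [r r0 r3] := cube_root2 R.
by apply: solvable_feasible; apply: (solvable_upper r0 r3).
Qed.

(** Here [10 * d * g] exceeds the rounded logarithm of [t] by at most [10 * d], which gives the
    slope [3 + 6 / (10 * d)]. Feasibility is recorded because the lower bound fails for the default
    value 0 of [Ntests]. *)
Lemma Ntests_upper (R : realType) d : (4 <= d)%N ->
  exists t0, forall t, (t0 <= t)%N ->
    (exists n, feasible 5 t 3 n) /\
    (10 * d * Ntests 5 t 3 <= (30 * d + 6) * (up_log 2 t + 10 * d))%N.
Proof.
move=> d4; have [g1 g1_ok] := poly_leq_exp (29 * d).
pose g0 := maxn g1 (5 * (105 * d)).
exists (2 ^ (10 * d * g0))%N => t t_large.
pose l := up_log 2 t; pose g := (l %/ (10 * d)).+1.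
have d0 : (0 < 10 * d)%N by rewrite muln_gt0 (leq_trans _ d4).
have gl : (10 * d * g <= l + 10 * d)%N.
  by rewrite mulnC /g mulSn addnC leq_add2r leq_trunc_div.
have lg : (l < 10 * d * g)%N by rewrite mulnC; apply: ltn_ceil.
have g0g : (g0 <= g)%N.
  rewrite -ltnS ltnS; apply: leqW; rewrite leq_divRL // mulnC.
  rewrite -(leq_exp2l _ _ (ltnSn 1)); apply: leq_trans t_large _.
  exact: up_logP.
have feas : feasible 5 t 3 (30 * (d * g) + 6 * g).
  apply: (@feasible5 R) => //.
  - by rewrite mulnA; apply: g1_ok; apply: leq_trans g0g; apply: leq_maxl.
  - by apply: leq_trans g0g; apply: leq_maxr.
  apply: leq_trans (up_logP t (ltnSn 1)) _.
  by rewrite leq_exp2l // mulnA ltnW.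
split; first by exists (30 * (d * g) + 6 * g)%N.
apply: leq_trans (leq_mul (leqnn _) (Ntests_ub feas)) _.
rewrite (_ : 10 * d * (30 * (d * g) + 6 * g) = (30 * d + 6) * (10 * d * g))%N.
  by rewrite leq_mul2l gl orbT.
by clear; nia.
Qed.

(** For [t >= 4], [t ^ 3 <= 64 * 'C(t, 3)], and [64 = 2 ^ 6]. *)
Lemma Ntests_lower p t : (4 <= t)%N -> (exists n, feasible p t 3 n) ->
  (t ^ 3 <= 2 ^ (Ntests p t 3 + 6))%N.
Proof.
move=> t4 /Ntests_feasible /feasible_lower le_bin.
rewrite expnD; apply: leq_trans (leq_mul le_bin (leqnn _)).
have := bin_ffact t 3; rewrite !ffactnS ffactn0 muln1.
case: t t4 {le_bin} => [|[|[|t]]] // t4 /=.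
by move: 'C(_, _) => C; rewrite (_ : 3`! = 6)%N //; nia.
Qed.

(** * Binary logarithms *)

Section Log2.
Variable R : realType.

Lemma ln2_gt0 : 0 < ln 2 :> R.
Proof. by rewrite ln_gt0 // ltr1n. Qed.

Lemma log2_expn n : log2 ((2 ^ n)%:R : R) = n%:R.
Proof.
rewrite /log2 natrX lnXn // -[ln 2 *+ n]mulr_natl mulfK // gt_eqF //.
exact: ln2_gt0.
Qed.

Lemma le_log2 m n : (0 < m)%N -> (m <= n)%N -> log2 (m%:R : R) <= log2 n%:R.
Proof.
move=> m0 mn; rewrite /log2 ler_pM2r ?invr_gt0 ?ln2_gt0 //.
by rewrite ler_ln ?posrE ?ltr0n ?ler_nat // (leq_trans m0).
Qed.

Lemma up_log_le t : (1 < t)%N -> (up_log 2 t)%:R <= log2 (t%:R : R) + 1.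
Proof.
move=> t1; have l0 : (0 < up_log 2 t)%N by rewrite up_log_gt0.
rewrite -(prednK l0) -natr1 lerD2r -[leLHS]log2_expn; apply: le_log2.
  by rewrite expn_gt0.
by apply: ltnW; apply: up_log_gtn.
Qed.

Lemma log2_cube t n : (0 < t)%N -> (t ^ 3 <= 2 ^ n)%N -> 3 * log2 (t%:R : R) <= n%:R.
Proof.
move=> t0 tn; rewrite -[n%:R]log2_expn.
apply: le_trans (le_log2 _ tn); last by rewrite expn_gt0 t0.
by rewrite /log2 natrX lnXn ?ltr0n // -[ln _ *+ 3]mulr_natl mulrA.
Qed.

End Log2.

Theorem theorem2 (R : realType) : Cconst R 5 3 = (3%:R : R)%:E.
Proof.
(* The ratio converges, so its limit superior is its limit. *)
rewrite /Cconst; apply: (cvg_limn_einf_sup _).2; apply: cvg_EFin.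
  by near=> t.
apply/cvgrPdist_le => e e0.
(* Since [6 / (10 * d) < 1/d <= e], room is left for the additive terms. *)
pose d := maxn 4 (Num.bound e^-1).
have d4 : (4 <= d)%N by apply: leq_maxl.
have d0 : 0 < d%:R :> R by rewrite ltr0n (leq_trans _ d4).
have de : d%:R^-1 <= e.
  rewrite invf_ple ?posrE // ltW //.
  apply: lt_le_trans (archi_boundP _) _; first by rewrite invr_ge0 ltW.
  by rewrite ler_nat leq_maxr.
have [t0 t0_ok] := Ntests_upper R d4.
(* The first entry makes the additive term of the upper bound at most [log2 t], which fits between
   [30 * d + 6] and [30 * d + 10]; the second makes the 6 of the lower bound at most
   [e * log2 t]. *)
pose n := maxn ((30 * d + 6) * (10 * d + 1)) (Num.bound (6 / e)).
near=> t.
have tt0 : (t0 <= t)%N by near: t; apply: nbhs_infty_ge.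
have tn : (2 ^ n <= t)%N by near: t; apply: nbhs_infty_ge.
have t4 : (4 <= t)%N by near: t; apply: nbhs_infty_ge.
have [feas ub] := t0_ok t tt0.
have lb := log2_cube R (leq_trans (isT : 0 < 4)%N t4) (Ntests_lower t4 feas).
have ul := up_log_le R (leq_trans (isT : 1 < 4)%N t4).
rewrite /=; set N := (Ntests 5 t 3)%:R; set x := log2 t%:R in lb ul *.
have nx : n%:R <= x by rewrite -[leLHS]log2_expn; apply: le_log2; rewrite ?expn_gt0.
have {}ub : 10 * d%:R * N <= (30 * d%:R + 6) * (x + 1 + 10 * d%:R).
  move: ub; rewrite -(ler_nat R) !(natrM, natrD) => /le_trans; apply.
  apply: ler_wpM2l; last by rewrite lerD2r.
  by rewrite addr_ge0 // mulr_ge0 // ltW.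
have {}lb : 3 * x <= N + 6 by rewrite -natrD.
have n1 : (30 * d%:R + 6) * (10 * d%:R + 1) <= x.
  apply: le_trans nx; apply: (@le_trans _ _ ((30 * d + 6) * (10 * d + 1))%:R).
    by rewrite !(natrM, natrD).
  rewrite ler_nat.
  exact: leq_maxl.
have n2 : 6 / e <= x.
  apply: le_trans nx; apply: (@le_trans _ _ (Num.bound (6 / e))%:R).
    by apply/ltW/archi_boundP; rewrite divr_ge0 // ltW.
  by rewrite ler_nat leq_maxr.
have x0 : 0 < x by apply: lt_le_trans n2; rewrite divr_gt0.
rewrite ler_pdivrMr // in n2.
have ub2 : N <= (3 + d%:R^-1) * x.
  rewrite -(ler_pM2l (_ : 0 < 10 * d%:R)); last by rewrite mulr_gt0.
  have -> : 10 * d%:R * ((3 + d%:R^-1) * x) = (30 * d%:R + 10) * x by field; rewrite gt_eqF.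
  by apply: le_trans ub _; nra.
rewrite ler_distl; apply/andP; split.
  rewrite lerBlDr ler_pdivrMr //; apply: le_trans ub2 _.
  by rewrite ler_wpM2r ?lerD2l // ltW.
rewrite -lerBlDr ler_pdivlMr //; lra.
Unshelve. all: end_near.
Qed.
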